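(* The cut rule $\mathsf{i}{\uparrow}$, whose instances are $A\otimes\overline{A}\ \longrightarrow\ \emptyset$ for an arbitrary graph $A$, is admissible for the system $\mathsf{GS}$: for every graph $G$, every context $C[\cdot]_R$ and every graph $A$, if $\vdash_{\mathsf{GS}} C[A\otimes\overline{A}]_R$ then $\vdash_{\mathsf{GS}} C[\emptyset]_R$.
   Context: Atoms: fix a countable set $\mathcal V$ of propositional variables and a disjoint copy $\overline{\mathcal V}=\{\overline a: a\in\mathcal V\}$; atoms are elements of $\mathcal V\cup\overline{\mathcal V}$, with $\overline{\overline a}=a$. A graph is a finite simple undirected graph $G=(V_G,E_G)$ whose vertices are each labelled by an atom; graphs are identified up to label-preserving isomorphism. $\emptyset$ is the empty graph; an atom $a$ also denotes the one-vertex graph labelled $a$. For graphs $G,H$ on disjoint vertex sets, the par $G\sqcup H$ is their disjoint union, and the tensor $G\otimes H$ is their disjoint union together with all edges $vw$ with $v\in V_G$, $w\in V_H$. The dual $\overline G$ has the same vertices as $G$, an edge $vw$ ($v\neq w$) iff $vw\notin E_G$, and each label replaced by its dual atom. A context is a graph $C$ together with a subset $R\subseteq V_C$; for a graph $M$, $C[M]_R$ is the graph obtained from $C\sqcup M$ by adding all edges between vertices of $M$ and vertices of $R$. A module of a graph $G$ is an induced subgraph $M$ such that every vertex outside $M$ is adjacent to all vertices of $M$ or to none; a graph $P$ is prime if $|V_P|\ge 2$ and its only modules are $\emptyset$, singletons and $P$. For a graph $G$ with vertices $v_1,\dots,v_n$ and graphs $H_1,\dots,H_n$, $G\langle H_1,\dots,H_n\rangle$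 is obtained by replacing each $v_i$ by $H_i$, keeping edges inside each $H_i$, and putting all edges between $H_i$ and $H_j$ ($i\ne j$) iff $v_iv_j\in E_G$; $\overline G\langle\dots\rangle$ uses the same vertex order. Rules of $\mathsf{GS}$ (instances premise $\longrightarrow$ conclusion, $a$ an atom, $A,B,M_i,N_i$ graphs): $\mathsf{ai}{\downarrow}$: $\emptyset\longrightarrow \overline a\sqcup a$; $\mathsf{ss}{\downarrow}$: $B[A]_S\longrightarrow B\sqcup A$ where $S\subseteq V_B$, $S\neq\emptyset$, $A\ne\emptyset$; $\mathsf{p}{\downarrow}$: $(M_1\sqcup N_1)\otimes\cdots\otimes(M_n\sqcup N_n)\longrightarrow \overline P\langle M_1,\dots,M_n\rangle\sqcup P\langle N_1,\dots,N_n\rangle$ where $P$ is prime, $n=|V_P|\ge 4$, and all $M_i\ne\emptyset$. A derivation in a rule system $\mathsf S$ from $G$ to $H$ is a finite sequence $G=G_0,\dots,G_k=H$ where each $G_{j+1}$ arises from $G_j$ by a label-preserving isomorphism or as follows: $G_j=C[X]_R$, $G_{j+1}=C[Y]_R$ for some context $C[\cdot]_R$ and some instance $X\longrightarrow Y$ of a rule of $\mathsf S$. A proof is a derivation from $\emptyset$; $\vdash_{\mathsf S}G$ means $G$ has a proof in $\mathsf S$. *)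

(* Defs.v *)
From HB Require Import structures.
From mathcomp Require Import all_boot.

Set Implicit Arguments.
Unset Strict Implicit.
Unset Printing Implicit Defensive.

(* [inl a] is the variable [a], [inr a] its formal negation. *)
Definition atom (V : countType) : Type := (V + V)%type.

Definition dual_atom (V : countType) (x : atom V) : atom V :=
  match x with inl a => inr a | inr a => inl a end.

Record graph (V : countType) : Type := Graph {
  vert :> finType;
  edge : rel vert;
  label : vert -> atom V;
  edge_sym : symmetric edge;
  edge_irrefl : irreflexive edge
}.

(* Graphs are not quotiented: the identification up to label-preserving
   isomorphism is made by the isomorphism steps of derivations. *)
Definition graph_iso (V : countType) (G H : graph V) : Prop :=
  exists f : G -> H,
    [/\ bijective f,
        forall v w, edge (f v) (f w) = edge v w
      & forall v, label (f v) = label v].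

Section Constructions.
Variable V : countType.
Implicit Types G H A B C M : graph V.

Lemma false_sym (T : Type) : symmetric (fun _ _ : T => false).
Proof. by []. Qed.

Lemma false_irrefl (T : Type) : irreflexive (fun _ _ : T => false).
Proof. by []. Qed.

Definition empty_graph : graph V :=
  Graph (vert := void) (fun v => match v with end)
    (@false_sym void) (@false_irrefl void).

Definition atom_graph (a : atom V) : graph V :=
  Graph (vert := unit) (fun=> a) (@false_sym unit) (@false_irrefl unit).

(* Disjoint union of G and H, plus all edges between the vertices of G
   satisfying r and the vertices of H. *)
Definition glue_edge G H (r : pred G) (u v : G + H) : bool :=
  match u, v with
  | inl x, inl y => edge x y
  | inr x, inr y => edge x y
  | inl x, inr _ => r x
  | inr _, inl y => r y
  end.

Definition glue_label G H (u : G + H) : atom V :=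
  match u with inl x => label x | inr y => label y end.

Lemma glue_sym G H (r : pred G) : symmetric (glue_edge (H := H) r).
Proof. by move=> [x|x] [y|y] //=; apply: edge_sym. Qed.

Lemma glue_irrefl G H (r : pred G) : irreflexive (glue_edge (H := H) r).
Proof. by move=> [x|x] /=; apply: edge_irrefl. Qed.

Definition glue G H (r : pred G) : graph V :=
  Graph (vert := (G + H)%type) (@glue_label G H)
    (@glue_sym G H r) (@glue_irrefl G H r).

Definition par G H : graph V := glue H (fun _ : G => false).

Definition tensor G H : graph V := glue H (fun _ : G => true).

(* C[M]_R *)
Definition plug C (R : {set C}) M : graph V := glue M (fun x : C => x \in R).

Definition dual_edge G (v w : G) : bool := (v != w) && ~~ edge v w.

Lemma dual_sym G : symmetric (@dual_edge G).
Proof. by move=> v w; rewrite /dual_edge eq_sym edge_sym. Qed.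

Lemma dual_irrefl G : irreflexive (@dual_edge G).
Proof. by move=> v; rewrite /dual_edge eqxx. Qed.

Definition dual G : graph V :=
  Graph (vert := vert G) (fun v => dual_atom (label v))
    (@dual_sym G) (@dual_irrefl G).

(* Disjoint union of the H i, plus all edges between H i and H j whenever
   i != j and e i j; [tagged_as u v] is [tagged v] transported to the component
   of u. *)
Definition subst_edge (I : finType) (e : rel I) (H : I -> graph V)
    (u v : {i : I & H i}) : bool :=
  if tag u == tag v then edge (tagged u) (tagged_as u v) else e (tag u) (tag v).

Lemma subst_sym (I : finType) (e : rel I) (H : I -> graph V) :
  symmetric e -> symmetric (subst_edge e (H := H)).
Proof.
move=> esym [i x] [j y]; rewrite /subst_edge /= (eq_sym j i).
case: eqVneq => [eq_ij|_]; last exact: esym.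
by case: j / eq_ij y => y; rewrite !tagged_asE edge_sym.
Qed.

Lemma subst_irrefl (I : finType) (e : rel I) (H : I -> graph V) :
  irreflexive (subst_edge e (H := H)).
Proof. by case=> i x; rewrite /subst_edge /= eqxx tagged_asE edge_irrefl. Qed.

Definition substitute (I : finType) (e : rel I) (esym : symmetric e)
    (H : I -> graph V) : graph V :=
  Graph (vert := {i : I & H i}) (fun u => label (tagged u))
    (subst_sym (H := H) esym) (@subst_irrefl I e H).

(* G<H_1, ..., H_n>; the family is indexed by the vertices of G rather than by
   an enumeration of them. The vertices of [dual G] are those of G, so the same
   family can be substituted in [dual G]. *)
Definition compose G (H : G -> graph V) : graph V := substitute (@edge_sym V G) H.

Lemma true_sym (T : Type) : symmetric (fun _ _ : T => true).
Proof. by []. Qed.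

(* The n-ary tensor H_1 (x) ... (x) H_n. *)
Definition big_tensor (I : finType) (H : I -> graph V) : graph V :=
  substitute (@true_sym I) H.

Definition is_module G (M : {set G}) : Prop :=
  forall v : G, v \notin M ->
    (forall w, w \in M -> edge v w) \/ (forall w, w \in M -> ~~ edge v w).

Definition prime_graph G : Prop :=
  2 <= #|vert G| /\
  forall M : {set G}, is_module M ->
    [\/ M = set0, exists v, M = [set v] | M = [set: G]].

Definition nonempty G : Prop := 0 < #|vert G|.

(* A rule relates the premise and the conclusion of each of its instances. *)
Definition rule_system : Type := graph V -> graph V -> Prop.

Inductive GS : rule_system :=
| GS_ai (a : atom V) :
    GS empty_graph (par (atom_graph (dual_atom a)) (atom_graph a))
| GS_ss (A B : graph V) (S : {set B}) :
    S != set0 -> nonempty A -> GS (plug S A) (par B A)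
| GS_p (P : graph V) (M N : P -> graph V) :
    prime_graph P -> 4 <= #|vert P| -> (forall i, nonempty (M i)) ->
    GS (big_tensor (fun i : P => par (M i) (N i)))
       (par (@compose (dual P) M) (compose N)).

Inductive derivation_step (S : rule_system) : graph V -> graph V -> Prop :=
| step_iso G H : graph_iso G H -> derivation_step S G H
| step_rule C (R : {set C}) X Y :
    S X Y -> derivation_step S (plug R X) (plug R Y).

Inductive derivation (S : rule_system) (G : graph V) : graph V -> Prop :=
| derivation_nil : derivation S G G
| derivation_cons H K :
    derivation S G H -> derivation_step S H K -> derivation S G K.

Definition provable (S : rule_system) G : Prop := derivation S empty_graph G.

End Constructions.

Arguments empty_graph {V}.
Arguments GS {V}.

(* Main.v *)
Require Import Defs.
From HB Require Import structures.
From mathcomp Require Import all_boot.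

Set Implicit Arguments.
Unset Strict Implicit.
Unset Printing Implicit Defensive.

(** Cut elimination goes through a sequent calculus whose sequents are graphs,
the comma being par. Besides axioms it has two rules: from [G, M] and [C] infer
[G, C[M]_R]; and, for a prime [P] and nonempty [M_i], [N_i], from all the
[G_i, M_i, N_i] infer [G_1, ..., G_n, dual P<M_1, ..., M_n>, P<N_1, ..., N_n>].
Every premise is an induced subgraph of its conclusion, so all sequents of a
derivation are sets of vertices of one fixed graph.

A cut on a connected graph [A] is pushed up until [A] is principal on both sides.
The principal cases only need cuts on smaller graphs because, in a context
[H[M]] smaller than [A], a module [M] can be replaced by [G] whenever
[G, dual M] is derivable: cut [H[M]] against the derivable
[G, dual H[dual M], H]. Prime quotients match because their classes are the
maximal modules.

A step of GS from [X] to [Y] makes [dual X, Y] derivable, in every context, so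
provable graphs are derivable by cut; conversely ss and p simulate the two rules. *)

(** Pushing a cut up relies on connectedness: a connected cut graph separated from its context
    either lies inside one premise of a rule or is made by that rule, whereas a disconnected one can
    be shared between premises. A graph or its dual is always connected, so one side can be chosen
    to be; if the other side is not, its derivation is used as it stands. The only measure is the
    number of vertices of the cut graph: pushing up on one side is a structural induction during
    which the other premise stays fixed. The obstacle is that two principal rules may decompose [A]
    along unrelated, overlapping modules, so their premises do not face each other; replacing
    modules realigns them. Replacement needs additional copies of some vertices, so the induction
    hypothesis must range over all ambient graphs. After a cut the quotient may lose colours on one
    side; rules are therefore rebuilt with an admissible version of the prime rule that asks neither
    for primality nor for nonempty parts. *)

Ltac solve_bool := move=> *; repeat (match goal with
  | H : is_true true -> _ |- _ => specialize (H isT)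
  | H : is_true false |- _ => discriminate H
  | H : ?b = ?c |- _ => discriminate H
  end); done.

(* Decides a boolean tautology in membership atoms, the hypotheses being
   implications of the goal. *)
Ltac solve_mem := rewrite ?inE /=; try done; repeat (match goal with
  |- context [in_mem ?x ?A] => case: (in_mem x A) end; rewrite /=; try done; try solve_bool).

Ltac mem_split := repeat match goal with
  | H : is_true (_ && _) |- _ => case/andP: H => ? ?
  | H : is_true (_ || _) |- _ => case/orP: H => ?
  end.

Ltac mem_forward := repeat match goal with
  | S : {subset ?X <= ?Y}, H : is_true (?u \in ?X) |- _ =>
    lazymatch goal with
    | _ : is_true (u \in Y) |- _ => fail
    | |- _ => have ? : u \in Y by exact: (S u H)
    end
  | S : forall y, is_true (y \in ?B) -> is_true (?g y \in ?A),
    H : is_true (?u \in ?B) |- _ =>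
    lazymatch goal with
    | _ : is_true (g u \in A) |- _ => fail
    | |- _ => have ? : g u \in A by exact: (S u H)
    end
  end.

Ltac mem_rewrite := repeat match goal with
  | H : is_true (~~ (?u \in ?X)), H' : is_true (?u \in ?X) |- _ => by rewrite H' in H
  | H : is_true (?u \in ?X) |- context [?u \in ?X] => rewrite !H
  | H : is_true (~~ (?u \in ?X)) |- context [?u \in ?X] => rewrite !(negbTE H)
  end; rewrite /= ?orbT ?andbT ?orbF ?andbF; try done.

Ltac solve_subset := let u := fresh "u" in let h := fresh "h" in
  move=> u h; rewrite ?inE; rewrite ?inE in h; mem_split; mem_forward; mem_rewrite.

(** * A sequent calculus on induced subgraphs *)

Section Calculus.
Variable V : countType.
Implicit Types (T : graph V).

Definition disj (T : finType) (A B : {set T}) : Prop :=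
  forall x, x \in A -> x \notin B.

(** Asking for [dual_edge], and not only for the absence of edges, makes separated sets disjoint. *)
Definition dsep T (A B : {set T}) : Prop :=
  forall x y, x \in A -> y \in B -> dual_edge x y.

Definition color_class (T I : finType) (S : {set T}) (c : T -> I) (i : I) : {set T} :=
  [set u in S | c u == i].

(* The vertices of colour [i] form the [i]-th premise of the prime rule: [X] is
   [dual P<M>], [Y] is [P<N>], with [q] the edges of [P], and the rest of [S] is
   the side context. *)
Record coloring T (I : finType) (S X Y : {set T}) (c : T -> I) (q : rel I) :
    Prop := Coloring {
  col_sym : symmetric q;
  col_X : {subset X <= S};
  col_Y : {subset Y <= S};
  col_XY : disj X Y;
  col_sepX : dsep X (S :\: X);
  col_sepY : dsep Y (S :\: Y);
  col_edge : forall u v, u \in S -> v \in S -> c u != c v ->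
    edge u v = [&& u \in X, v \in X & ~~ q (c u) (c v)]
            || [&& u \in Y, v \in Y & q (c u) (c v)] }.

(** Stated for relations and not for graphs: exchanging [X] and [Y] negates [q], which destroys
    irreflexivity but preserves modules, as the diagonal is never consulted. *)
Definition qmodule (I : finType) (q : rel I) (K J : {set I}) : Prop :=
  forall k j j', k \in K -> k \notin J -> j \in J -> j' \in J -> q k j = q k j'.

Definition qprime (I : finType) (q : rel I) (K : {set I}) : Prop :=
  4 <= #|K| /\
  forall J : {set I}, {subset J <= K} -> qmodule q K J -> #|J| <= 1 \/ J = K.

(** With [M] empty, the plug rule is the mix rule. In the prime rule the premises for colours
    outside [c @: S] are empty sequents, so quantifying over all of [I] is harmless. *)
Inductive derivable T : {set T} -> Prop :=
| derivable_nil : derivable set0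
| derivable_ax x y : label x = dual_atom (label y) -> ~~ edge x y -> derivable [set x; y]
| derivable_plug (S1 S2 M R : {set T}) :
    disj S1 S2 -> {subset M <= S1} -> {subset R <= S2} ->
    dsep M (S1 :\: M) ->
    (forall u v, u \in S1 -> v \in S2 -> edge u v = (u \in M) && (v \in R)) ->
    derivable S1 -> derivable S2 -> derivable (S1 :|: S2)
| derivable_prime (I : finType) (q : rel I) (c : T -> I) (S X Y : {set T}) :
    coloring S X Y c q -> qprime q (c @: S) ->
    (forall i, i \in c @: S -> exists x, x \in X /\ c x = i) ->
    (forall i, i \in c @: S -> exists y, y \in Y /\ c y = i) ->
    (forall i, derivable (color_class S c i)) -> derivable S.

Lemma dsep_sym T (A B : {set T}) : dsep A B -> dsep B A.
Proof. by move=> h x y hx hy; rewrite dual_sym; apply: h. Qed.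

Lemma dual_edgeE T (x y : T) : dual_edge x y -> edge x y = false.
Proof. by case/andP=> _ /negbTE. Qed.

Lemma dsep_disj T (A B : {set T}) : dsep A B -> disj A B.
Proof. by move=> h x hA; apply/negP=> hB; have := h x x hA hB; rewrite dual_irrefl. Qed.

Lemma dual_edge_mem T (S : {set T}) x y :
  x \in S -> y \notin S -> ~~ edge x y -> dual_edge x y.
Proof.
by move=> xS yS e; rewrite /dual_edge e andbT; apply: contraNneq yS => <-.
Qed.

Lemma coloring_edge_sep T (I : finType) (S X Y : {set T}) c (q : rel I) u v :
  coloring S X Y c q -> u \in S -> v \in S -> u \in X -> v \notin X ->
  dual_edge u v.
Proof.
by case=> _ _ _ _ h _ _ uS vS uX vX; apply: h; rewrite // !inE vX.
Qed.

Lemma coloring_swap T (I : finType) (S X Y : {set T}) c (q : rel I) :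
  coloring S X Y c q -> coloring S Y X c (fun i j => ~~ q i j).
Proof.
case=> qs hX hY hXY sX sY he; split=> //.
- by move=> i j; rewrite qs.
- by move=> x xY; apply/negP=> xX; have := hXY x xX; rewrite xY.
- by move=> u v uS vS cuv; rewrite he // orbC negbK.
Qed.

Lemma coloring_sub T (I : finType) (S S' X Y : {set T}) c (q : rel I) :
  {subset S' <= S} -> coloring S X Y c q ->
  coloring S' (X :&: S') (Y :&: S') c q.
Proof.
move=> hS [qs hX hY hXY sX sY he]; split=> //.
- by move=> x; rewrite !inE => /andP[].
- by move=> x; rewrite !inE => /andP[].
- by move=> x; rewrite !inE => /andP[/hXY /negbTE ->].
- move=> x y; rewrite !inE => /andP[xX xS'] /andP[yX yS'].
  by apply: sX => //; rewrite !inE hS // andbT; move: yX; rewrite yS' andbT.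
- move=> x y; rewrite !inE => /andP[xX xS'] /andP[yX yS'].
  by apply: sY => //; rewrite !inE hS // andbT; move: yX; rewrite yS' andbT.
- by move=> u v uS vS cuv; rewrite !inE uS vS !andbT he //; apply: hS.
Qed.

(** Invariance under isomorphism. The map goes from the new graph to the old one because a colouring
    then pulls back as [c \o h]. *)
Lemma derivable_preim T T' (h : T' -> T) (S : {set T}) :
  derivable S -> forall S' : {set T'}, S = h @: S' ->
  {in S' &, injective h} ->
  {in S' &, forall u v, edge (h u) (h v) = edge u v} ->
  {in S', forall u, label (h u) = label u} -> derivable S'.
Proof.
elim=> {S} [|x y lxy exy|S1 S2 M R dS sM sR sep he p1 IH1 p2 IH2|I q c S X Y col qp fX fY _
  IH] S' eS inj hedge hlab.
- suff -> : S' = set0 by exact: derivable_nil.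
  by apply/setP=> u; rewrite inE; apply/negP=> /(imset_f h); rewrite -eS inE.
- have /imsetP[a aS ea] : x \in h @: S' by rewrite -eS !inE eqxx.
  have /imsetP[b bS eb] : y \in h @: S' by rewrite -eS !inE eqxx orbT.
  have -> : S' = [set a; b].
    apply/setP=> u; rewrite !inE; apply/idP/orP.
      move=> uS; have := imset_f h uS; rewrite -eS !inE ea eb => /orP[]/eqP e.
        by left; apply/eqP/inj.
      by right; apply/eqP/inj.
    by case=> /eqP ->.
  by apply: derivable_ax; rewrite -?hlab -?hedge -?ea -?eb.
- have hS : {subset S1 :|: S2 <= h @: S'} by rewrite eS.
  have im (P : {set T}) : {subset P <= S1 :|: S2} ->
      P = h @: (S' :&: h @^-1: P).
    move=> hP; apply/setP=> x; apply/idP/imsetP.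
      move=> xP; have /imsetP[u uS ex] := hS _ (hP _ xP).
      by exists u => //; rewrite !inE uS -ex.
    by case=> u; rewrite !inE => /andP[_ ?] ->.
  have mS u : u \in S' -> (h u \in S1) || (h u \in S2).
    by move=> /(imset_f h); rewrite -eS inE.
  have -> : S' = (S' :&: h @^-1: S1) :|: (S' :&: h @^-1: S2).
    by apply/setP=> u; rewrite !inE -andb_orr; case uS: (u \in S') => //=; rewrite mS.
  have i1 : {subset S' :&: h @^-1: S1 <= S'} by move=> u; rewrite inE => /andP[].
  have i2 : {subset S' :&: h @^-1: S2 <= S'} by move=> u; rewrite inE => /andP[].
  apply: (@derivable_plug _ _ _ (S' :&: h @^-1: M) (S' :&: h @^-1: R)).
  + by move=> u; rewrite !inE => /andP[-> /dS].
  + by move=> u; rewrite !inE => /andP[-> /sM].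
  + by move=> u; rewrite !inE => /andP[-> /sR].
  + move=> u v; rewrite !inE => /andP[uS uM] /andP[hv /andP[vS v1]].
    have vM : h v \notin M by move: hv; rewrite vS.
    have := sep (h u) (h v) uM; rewrite !inE vM v1 => /(_ isT)/andP[_ e].
    rewrite /dual_edge -hedge // e andbT; apply: contraNneq vM => <-; exact: uM.
  + move=> u v; rewrite !inE => /andP[uS u1] /andP[vS v2].
    by rewrite -hedge // he // uS vS.
  + apply: IH1 => [|u v /i1 ? /i1 ?|u v /i1 ? /i1 ?|u /i1 ?]; auto.
    by apply: im => u; rewrite inE => ->.
  + apply: IH2 => [|u v /i2 ? /i2 ?|u v /i2 ? /i2 ?|u /i2 ?]; auto.
    by apply: im => u; rewrite inE => ->; rewrite orbT.
- have mS u : u \in S' -> h u \in S by move=> /(imset_f h); rewrite -eS.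
  have ec : (c \o h) @: S' = c @: S by rewrite eS -imset_comp.
  case: col => qs hX hY hXY sX sY he.
  apply: (@derivable_prime _ I q (c \o h) _ (S' :&: h @^-1: X) (S' :&: h @^-1: Y)).
  + split=> //.
    * by move=> u; rewrite inE => /andP[].
    * by move=> u; rewrite inE => /andP[].
    * by move=> u; rewrite !inE => /andP[-> /hXY].
    * move=> u v; rewrite !inE => /andP[uS uM] /andP[hv vS].
      have vM : h v \notin X by move: hv; rewrite vS.
      apply: (@dual_edge_mem _ (h @^-1: X)); rewrite ?inE // -hedge //.
      by have := sX (h u) (h v) uM; rewrite !inE vM mS // => /(_ isT)/andP[].
    * move=> u v; rewrite !inE => /andP[uS uM] /andP[hv vS].
      have vM : h v \notin Y by move: hv; rewrite vS.
      apply: (@dual_edge_mem _ (h @^-1: Y)); rewrite ?inE // -hedge //.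
      by have := sY (h u) (h v) uM; rewrite !inE vM mS // => /(_ isT)/andP[].
    * by move=> u v uS vS /= cuv; rewrite -hedge // he ?mS // !inE uS vS.
  + by rewrite ec.
  + move=> i; rewrite ec => /fX[x [xX <-]].
    have := hX x xX; rewrite eS => /imsetP[u uS eu].
    by exists u; rewrite !inE /= -eu uS.
  + move=> i; rewrite ec => /fY[x [xX <-]].
    have := hY x xX; rewrite eS => /imsetP[u uS eu].
    by exists u; rewrite !inE /= -eu uS.
  + move=> i; have i1 : {subset color_class S' (c \o h) i <= S'}.
      by move=> u; rewrite !inE => /andP[].
    apply: (IH i) => [|u v /i1 ? /i1 ?|u v /i1 ? /i1 ?|u /i1 ?]; auto.
    apply/setP=> x; rewrite !inE; apply/andP/imsetP.
      rewrite eS => -[/imsetP[u uS ->] cu]; exists u => //.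
      by rewrite !inE uS.
    by case=> u; rewrite !inE => /andP[uS cu] ->; rewrite mS.
Qed.

(** Being prime is decidable, so only size three needs an argument: there a module of two elements
    always exists. *)
Lemma qprime_or_split (I : finType) (q : rel I) (K : {set I}) :
  symmetric q -> 3 <= #|K| -> qprime q K \/
  exists J : {set I}, [/\ {subset J <= K}, qmodule q K J, 1 < #|J| & #|J| < #|K| ].
Proof.
move=> qs K3.
pose good := [exists J : {set I}, [&& J \subset K, 1 < #|J|, #|J| < #|K| &
   [forall k in K :\: J, forall j in J, forall j' in J, q k j == q k j']]].
case G: good.
  right; case/existsP: G => J /and4P[/subsetP sJ J1 JK /forall_inP h].
  exists J; split=> // k j j' kK kJ jJ j'J; apply/eqP.
  have kKJ : k \in K :\: J by rewrite inE kJ.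
  have /forall_inP h1 := h k kKJ.
  by have /forall_inP h2 := h1 j jJ; apply: h2.
have H (J : {set I}) : {subset J <= K} -> qmodule q K J -> #|J| <= 1 \/ J = K.
  move=> sJ mJ; case: (leqP #|J| 1) => J1; [by left | right].
  apply/eqP; rewrite eqEcard; have /subsetP sJ' := sJ; rewrite sJ' leqNgt.
  apply/negP=> JK; suff : good by rewrite G.
  apply/existsP; exists J; apply/and4P; split=> //.
  apply/forall_inP=> k; rewrite inE => /andP[kJ kK].
  by apply/forall_inP=> j jJ; apply/forall_inP=> j' j'J; apply/eqP/mJ.
left; split=> //; move: K3; rewrite leq_eqVlt => /orP[/eqP K3|//].
move/esym: K3 => K3; have /card_gt0P[a aK] : 0 < #|K| by rewrite K3.
have /eqP/cards2P[b [d [bd eKa]]] : #|K :\ a| = 2.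
  by move: K3; rewrite (cardsD1 a) aK => -[].
have ab : a != b by apply/eqP=> e; have := set21 b d; rewrite -eKa -e !inE eqxx.
have ad : a != d by apply/eqP=> e; have := set22 b d; rewrite -eKa -e !inE eqxx.
have eK : K = [set a; b; d] by rewrite -setUA -eKa setD1K.
(* If [z] sees [x] and [y] alike, then [[set x; y]] is a proper module, which [H] excludes. *)
have two (x y : I) (xy : x != y) z : z != x -> z != y ->
   K = [set x; y; z] -> q z x = q z y -> False.
  move=> zx zy eK' e; case: (H [set x; y]).
  - by move=> t; rewrite eK' !inE => ->.
  - move=> k j j'; rewrite eK' !inE => /orP[->//|/eqP ->] _.
    by move=> /orP[]/eqP -> /orP[]/eqP ->.
  - by rewrite cards2 xy.
  - by move=> /setP/(_ z); rewrite eK' !inE eqxx (negbTE zx) (negbTE zy).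
(* Among three booleans two agree, and two pairs taken from a triple share a vertex. *)
case E1: (q a b == q a d).
  case: (two b d _ a) => //; [by rewrite eK; apply/setP=> t; rewrite !inE;
    do !case: eqP | exact/eqP].
case E2: (q b a == q b d).
  case: (two a d _ b) => //; [by rewrite eq_sym|by rewrite eK; apply/setP=> t;
    rewrite !inE; do !case: eqP | exact/eqP].
case: (two a b _ d) => //; rewrite 1?eq_sym //.
by move: E1 E2; rewrite (qs b a) (qs d a) (qs d b); do 3 case: (q _ _).
Qed.

End Calculus.

(** * The prime rule for arbitrary quotients *)

Section Coloring.
Variable V : countType.
Implicit Types (T : graph V).

(** No edge inside [X] leaves the class [i], so every edge leaving it joins its [Y] part to the
    vertices of [Y] whose colour is a [q]-neighbour of [i]: an instance of the plug rule. *)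
Lemma derivable_color_split T (I : finType) (q : rel I) c (S X Y : {set T}) i :
  coloring S X Y c q ->
  (forall u v, u \in X -> v \in X -> c u = i -> c v != i -> q i (c v)) ->
  derivable (color_class S c i) -> derivable (S :\: color_class S c i) -> derivable S.
Proof.
move=> col hX p1 p2; have eS : S = color_class S c i :|: (S :\: color_class S c i).
  by apply/setP=> u; rewrite !inE; case: (u \in S) => //=; case: eqP.
rewrite eS; apply: (@derivable_plug _ _ _ _ (Y :&: color_class S c i)
  [set v in S :\: color_class S c i | (v \in Y) && q i (c v)]) => //.
- by move=> u; rewrite !inE => /andP[-> /eqP ->]; rewrite eqxx.
- by move=> u; rewrite inE => /andP[].
- by move=> u; rewrite !inE => /andP[].
- move=> u v; rewrite !inE => /and3P[uY uS _] /and3P[hv vS cv].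
  apply: (col_sepY col); rewrite // !inE vS andbT.
  by move: hv; rewrite vS cv !andbT.
- move=> u v; rewrite !inE => /andP[uS /eqP cu] /andP[hv vS].
  have cv : c v != i by move: hv; rewrite vS.
  rewrite (col_edge col) //; last by rewrite cu eq_sym.
  rewrite cu uS vS cv eqxx /= !andbT.
  case uX: (u \in X); case vX: (v \in X) => //=.
  by rewrite (hX u v) // orbF.
Qed.

Lemma card_le1_eq (I : finType) (K : {set I}) i : #|K| <= 1 -> i \in K -> K = [set i].
Proof. by move=> K1 iK; apply/eqP; rewrite eq_sym eqEcard sub1set iK cards1. Qed.

Lemma color_class_disjoint T (I : finType) (S : {set T}) (c : T -> I) i j :
  i != j -> color_class (S :\: color_class S c i) c j = color_class S c j.
Proof.
move=> ij; apply/setP=> u; rewrite !inE; case: (u \in S) => //=; rewrite ?andbF //.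
case: (c u =P j) => [->|]; rewrite ?andbF // andbT; by rewrite eq_sym (negbTE ij).
Qed.

(* A colour missing from [X] or [Y] is split off by the first rule; a nontrivial
   module of [q] is treated first and then merged into a single colour. *)
Lemma derivable_coloring T (I : finType) (q : rel I) c (S X Y : {set T}) :
  coloring S X Y c q -> (forall i, derivable (color_class S c i)) -> derivable S.
Proof.
move: (ltnSn #|c @: S|); move: {2}(_.+1) => n.
elim: n c S X Y => // n IH c S X Y Sn col p.
have IHsub (S' : {set T}) : {subset S' <= S} -> #|c @: S'| < #|c @: S| ->
    (forall i, color_class S' c i = set0 \/ color_class S' c i = color_class S c i) ->
      derivable S'.
  move=> sS cS eS; apply: (IH c _ _ _ _ (coloring_sub sS col)).
    by apply: leq_trans cS _; rewrite -ltnS.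
  by move=> i; case: (eS i) => ->; [exact: derivable_nil | exact: p].
have restP i : i \in c @: S -> derivable (S :\: color_class S c i).
  move=> iK; apply: IHsub.
  - by move=> u; rewrite inE => /andP[].
  - apply: proper_card; apply/properP; split.
      by apply: imsetS; apply: subsetDl.
    by exists i => //; apply/imsetP=> -[u]; rewrite !inE => /andP[hu uS] eu; move: hu;
      rewrite uS eu eqxx.
  - move=> j; case: (eqVneq i j) => [<-|ij]; [left | right; exact: color_class_disjoint].
    by apply/setP=> u; rewrite !inE; case: (u \in S); rewrite ?andbF //=; case: eqP.
have [K0|[k kK]] := set_0Vmem (c @: S).
  have -> : S = set0.
    by apply/setP=> u; rewrite inE; apply/negP=> /(imset_f c); rewrite K0 inE.
  exact: derivable_nil.
case: (boolP [forall i in c @: S, [exists x in X, c x == i]]) => [/forall_inP fX|]; last first.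
  rewrite negb_forall_in => /exists_inP[i iK /exists_inPn hX].
  apply: (derivable_color_split (i := i) col) => //; last exact: restP.
  by move=> u v uX _ cu; have := hX u uX; rewrite cu eqxx.
case: (boolP [forall i in c @: S, [exists x in Y, c x == i]]) => [/forall_inP fY|]; last first.
  rewrite negb_forall_in => /exists_inP[i iK /exists_inPn hX].
  apply: (derivable_color_split (i := i) (coloring_swap col)) => //; last exact: restP.
  by move=> u v uX _ cu; have := hX u uX; rewrite cu eqxx.
case: (leqP #|c @: S| 1) => K1.
  have eK := card_le1_eq K1 kK; suff <- : color_class S c k = S by [].
  apply/setP=> u; rewrite inE; case uS: (u \in S) => //=.
  by have := imset_f c uS; rewrite eK inE.
case: (leqP #|c @: S| 2) => K2.
  have /eqP/cards2P[i [j [ij eK]]] : #|c @: S| = 2 by apply/eqP; rewrite eqn_leq K2.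
  have iK : i \in c @: S by rewrite eK !inE eqxx.
  have cS u : u \in S -> c u != i -> c u = j.
    by move=> uS cu; have := imset_f c uS; rewrite eK !inE (negbTE cu) => /eqP.
  (* With two colours, edges between the classes occur in [Y] only or in [X] only, according to
     [q i j], so a colour can be split off. *)
  case qij: (q i j).
    apply: (derivable_color_split (i := i) col) => //; last exact: restP.
    by move=> u v uX vX cu cv; rewrite (cS v (col_X col vX)).
  apply: (derivable_color_split (i := i) (coloring_swap col)) => //; last exact: restP.
  by move=> u v uX vX cu cv; rewrite (cS v (col_Y col vX)) // qij.
case: (qprime_or_split (col_sym col) K2) => [qp|[J [sJ mJ J1 JK]]].
  apply: (derivable_prime col qp) => // i iK.
    by have /exists_inP[x xX /eqP cx] := fX i iK; exists x.
  by have /exists_inP[x xX /eqP cx] := fY i iK; exists x.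
have /card_gt0P[j0 j0J] : 0 < #|J| by apply: ltn_trans J1.
(* The module [J] is contracted to [j0]: [q] does not distinguish its elements from outside, and the
   number of colours drops because [J] has at least two. *)
pose c' u := if c u \in J then j0 else c u.
have c'E u : u \in S -> c' u \in J -> c u \in J.
  by rewrite /c'; case cJ: (c u \in J) => // _; rewrite cJ.
have col' : coloring S X Y c' q.
  case: (col) => qs hX hY hXY sX sY he; split=> // u v uS vS cuv.
  have cuv' : c u != c v by apply: contraNneq cuv; rewrite /c' => ->.
  rewrite he //; suff -> : q (c u) (c v) = q (c' u) (c' v) by [].
  move: cuv; rewrite /c'; case: ifP => cu; case: ifP => cv //.
    by rewrite eqxx.
    by rewrite qs [RHS]qs => _; apply: mJ; rewrite ?imset_f ?cv.
  by move=> _; apply: mJ; rewrite ?imset_f ?cu.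
apply: (IH c' _ _ _ _ col').
  apply: (@leq_ltn_trans #|j0 |: (c @: S :\: J)|).
    apply: subset_leq_card; apply/subsetP=> i /imsetP[u uS ->].
    rewrite !inE /c'; case: ifP => cu; rewrite ?eqxx //.
    by rewrite cu imset_f // orbT.
  rewrite cardsU1 !inE j0J /=; apply: leq_trans (_ : #|c @: S| <= n); last by rewrite -ltnS.
  have sJ' : J \subset c @: S by apply/subsetP.
  by rewrite -(cardsID J (c @: S)) (setIidPr sJ') -addSn leq_add2r.
(* The contracted class keeps its old colours, all in [J], hence fewer than those of [S]. *)
move=> i; case: (eqVneq i j0) => [->|ij0].
  apply: IHsub.
  - by move=> u; rewrite inE => /andP[].
  - apply: leq_ltn_trans JK; apply: subset_leq_card; apply/subsetP=> k0 /imsetP[u].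
    rewrite inE => /andP[uS /eqP cu] ->; apply: c'E => //; by rewrite cu.
  - move=> j; case jJ: (j \in J); [right | left]; apply/setP=> u; rewrite !inE;
      case: (u \in S) => //=.
      by case: (c u =P j) => cu; rewrite ?andbF // andbT /c' cu jJ eqxx.
    case: (c u =P j) => cu; rewrite ?andbF // andbT /c' cu jJ.
    by apply/negP=> /eqP e; move: jJ; rewrite e j0J.
case iJ: (i \in J).
  have -> : color_class S c' i = set0; last exact: derivable_nil.
  apply/setP=> u; rewrite !inE; case: (u \in S) => //=.
  rewrite /c'; case: ifP => cu; first by rewrite eq_sym (negbTE ij0).
  by apply/negP=> /eqP e; move: cu; rewrite e iJ.
have -> : color_class S c' i = color_class S c i; last exact: p.
apply/setP=> u; rewrite !inE; case: (u \in S) => //=.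
rewrite /c'; case: ifP => cu //; rewrite eq_sym (negbTE ij0).
by apply/esym/negP=> /eqP e; move: cu; rewrite e iJ.
Qed.

Lemma derivable_union T (A B : {set T}) : dsep A B -> derivable A -> derivable B ->
  derivable (A :|: B).
Proof.
move=> s pA pB; apply: (@derivable_plug _ _ _ _ set0 set0) => //.
- exact: dsep_disj.
- by move=> u; rewrite inE.
- by move=> u; rewrite inE.
- by move=> u v; rewrite inE.
- by move=> u v uA vB; rewrite !inE; apply: dual_edgeE; apply: s.
Qed.

(** The colours met by [M] form a module of [q], so they are at most one or all. If all, a vertex
    [v] of [X] outside [M] sees the colours other than its own alike, and these form a module with
    at least three elements that misses [c v]. *)
Lemma qprime_module T (I : finType) (S X Y : {set T}) c (q : rel I) (M : {set T}) :
  coloring S X Y c q -> qprime q (c @: S) ->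
  (forall i, i \in c @: S -> exists x, x \in X /\ c x = i) ->
  {subset M <= X} -> M != X ->
  (forall v, v \in X -> v \notin M -> {in M &, forall m m', edge v m = edge v m'}) ->
  forall m m', m \in M -> m' \in M -> c m = c m'.
Proof.
move=> col [K4 qp] fX sM MX mM.
have MS u : u \in M -> u \in S by move=> uM; apply: (col_X col); apply: sM.
have ed u v : u \in X -> v \in X -> c u != c v -> edge u v = ~~ q (c u) (c v).
  move=> uX vX cuv; rewrite (col_edge col) ?(col_X col) // uX vX /=.
  by have /negbTE -> := col_XY col uX; rewrite orbF.
have sJ : {subset c @: M <= c @: S}.
  by move=> _ /imsetP[u uM ->]; apply: imset_f; apply: MS.
case: (qp (c @: M) sJ).
- move=> k j j' /fX[x [xX <-]] xJ /imsetP[m mm ej] /imsetP[m' mm' ej'].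
  have xM : x \notin M by apply: contra xJ => xM; apply: imset_f.
  have xm u : u \in M -> c x != c u.
    by move=> uM; apply: contraNneq xJ => ->; apply: imset_f.
  have := mM x xX xM m m' mm mm'; rewrite !ed ?xm ?xX ?(sM _ mm) ?(sM _ mm') // ej ej'.
  exact: negb_inj.
- move=> J1 m m' mm mm'.
  by have := imset_f c mm'; rewrite (card_le1_eq J1 (imset_f c mm)) inE => /eqP.
- move=> eJ; exfalso.
  have /subsetPn[v vX vM] : ~~ (X \subset M).
    by apply: contra MX => XM; rewrite eqEsubset XM andbT; apply/subsetP.
  have vK : c v \in c @: S by apply: imset_f; apply: (col_X col).
  case: (qp (c @: S :\ c v)).
  + by move=> k; rewrite inE => /andP[].
  + move=> k j j' kK; rewrite !inE kK andbT negbK => /eqP -> /andP[jv jK] /andP[jv' jK'].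
    move: jK jK'; rewrite -eJ => /imsetP[m mm ej] /imsetP[m' mm' ej'].
    have := mM v vX vM m m' mm mm'; rewrite !ed ?(sM _ mm) ?(sM _ mm') // -?ej -?ej' 1?eq_sym
      //.
    exact: negb_inj.
  + by move: K4; rewrite (cardsD1 (c v)) vK add1n ltnS => h /(leq_trans h).
  + by move=> /setP/(_ (c v)); rewrite !inE eqxx vK.
Qed.

End Coloring.

(** * Cut elimination *)

Section Principal.
Variable V : countType.
Implicit Types (T : graph V).

Definition connected T (A : {set T}) : Prop :=
  A != set0 /\ forall U : {set T}, {subset U <= A} -> dsep U (A :\: U) ->
  U = set0 \/ U = A.

Definition module_in T (M A : {set T}) : Prop :=
  forall v, v \in A -> v \notin M -> {in M &, forall m m', edge v m = edge v m'}.

(** What is kept of a last rule that makes [A]. For the plug rule, [R] is forgotten and only a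
    nontrivial module [M] and the splitting of the context remain. For the prime rule, [A] can be
    taken as the [X] part, since [X] and [Y] are exchangeable. *)
Inductive principal T (G A : {set T}) : Prop :=
| principal_ax x y : G = [set x] -> A = [set y] -> label x = dual_atom (label y) ->
    principal G A
| principal_plug (G1 G2 M : {set T}) : G = G1 :|: G2 -> dsep G1 G2 ->
    {subset M <= A} -> M != set0 -> M != A -> module_in M A ->
    derivable (G1 :|: M) -> derivable (G2 :|: (A :\: M)) -> principal G A
| principal_prime (I : finType) (q : rel I) (c : T -> I) (Y : {set T}) :
    coloring (G :|: A) A Y c q -> qprime q (c @: (G :|: A)) ->
    (forall i, i \in c @: (G :|: A) -> exists x, x \in A /\ c x = i) ->
    (forall i, i \in c @: (G :|: A) -> exists y, y \in Y /\ c y = i) ->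
    (forall i, derivable (color_class (G :|: A) c i)) -> principal G A.

Lemma dual_atomK : involutive (@dual_atom V).
Proof. by case. Qed.

Lemma connected_side T (A P : {set T}) : connected A ->
  (forall u v, u \in A -> v \in A -> u \in P -> v \notin P -> ~~ edge u v) ->
  {subset A <= P} \/ disj A P.
Proof.
case=> A0 cA h; case: (cA (A :&: P)).
- by move=> u; rewrite inE => /andP[].
- move=> u v; rewrite !inE => /andP[uA uP] /andP[vAP vA].
  have vP : v \notin P by move: vAP; rewrite vA.
  by apply: (@dual_edge_mem _ _ P) => //; apply: h.
- move=> e; right=> u uA; apply/negP=> uP.
  by have := in_set0 u; rewrite -e inE uA uP.
- by move=> e; left=> u; rewrite -{1}e inE => /andP[].
Qed.

Lemma qprime_neg (I : finType) (q : rel I) K :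
  qprime q K -> qprime (fun i j => ~~ q i j) K.
Proof.
case=> h1 h2; split=> // J sJ mJ; apply: h2 => // k j j' kK kJ jJ j'J.
by apply: negb_inj; apply: mJ.
Qed.

(** If [A] were smaller than [X], then [A] and [X :\: A] would both be proper modules of [X], each
    of a single colour, whereas a prime quotient has at least four. *)
Lemma qprime_isolated T (I : finType) (S X Y : {set T}) c (q : rel I) (A : {set T}) :
  coloring S X Y c q -> qprime q (c @: S) ->
  (forall i, i \in c @: S -> exists x, x \in X /\ c x = i) ->
  A != set0 -> {subset A <= X} ->
  (forall u v, u \in A -> v \in X -> v \notin A -> ~~ edge u v) -> A = X.
Proof.
move=> col qp fX /set0Pn[a aA] sA iA; apply/eqP; apply: contraT => nAX.
have h1 := qprime_module col qp fX sA nAX.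
have h2 := @qprime_module _ T I S X Y c q (X :\: A) col qp fX.
have /subsetPn[b bX bA] : ~~ (X \subset A).
  by apply: contra nAX => XA; rewrite eqEsubset XA andbT; apply/subsetP.
have e1 m : m \in A -> c m = c a.
  move=> mA; apply: h1 => // v vX vA u u' uA u'A.
  by rewrite !(edge_sym v) (negbTE (iA u v uA vX vA)) (negbTE (iA u' v u'A vX vA)).
have e2 m : m \in X :\: A -> c m = c b.
  move=> mA; apply: h2 => //.
  - by move=> u; rewrite inE => /andP[].
  - by apply/eqP=> e; have := sA a aA; rewrite -e inE aA.
  - move=> v vX; rewrite inE vX andbT negbK => vA u u'.
    rewrite !inE => /andP[uA uX] /andP[u'A u'X].
    by rewrite (negbTE (iA v u vA uX uA)) (negbTE (iA v u' vA u'X u'A)).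
  - by rewrite inE bX bA.
have : #|c @: S| <= 2.
  apply: (@leq_trans #|[set c a; c b]|); last by rewrite cards2; case: eqP.
  apply: subset_leq_card; apply/subsetP=> i /fX[x [xX <-]]; rewrite !inE.
  case xA: (x \in A); first by rewrite (e1 x xA) eqxx.
  by rewrite (e2 x) ?eqxx ?orbT // inE xX xA.
by case: qp => h _ /(leq_trans h).
Qed.

(* [E] is only carried along: [G] shrinks and must stay separated from it. *)
Lemma cut_reduce_principal T (A D E : {set T}) : connected A -> dsep A D ->
  (forall G, dsep G A -> dsep G D -> dsep G E -> principal G A ->
    derivable (G :|: A) -> derivable (G :|: D)) ->
  forall S, derivable S -> forall G, S = G :|: A -> dsep G A -> dsep G D ->
  dsep G E -> derivable (G :|: D).
Proof.
move=> cA sAD hprin S; elim=> {S} [|x y lxy exy|S1 S2 M R dS sM sR sep he p1 IH1 p2 IH2|I q c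
  S X Y col qp fX fY p IH] G eS sGA sGD sGE.
- case: cA => /set0Pn[a aA] _.
  by have := in_set0 a; rewrite eS inE aA orbT.
- have xy : x != y.
    by apply/eqP=> e; move: lxy; rewrite e; case: (label y).
  have mS u : (u == x) || (u == y) = (u \in G) || (u \in A).
    by rewrite -in_setU -eS !inE.
  have dGA u : u \in G -> u \notin A by exact: (dsep_disj sGA).
  apply: hprin => //; last by rewrite -eS; apply: derivable_ax.
  case: (@connected_side _ A [set x] cA).
  + by move=> u v uA vA; rewrite !inE => /eqP eu nv; have := mS v;
       rewrite vA orbT (negbTE nv) => /eqP ev; subst.
  + move=> sA; have eA : A = [set x].
      apply/eqP; rewrite eqEsubset; apply/andP; split; first exact/subsetP.
      by case: cA => /set0Pn[a aA] _; have := sA a aA; rewrite sub1set inE => /eqP <-.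
    apply: (@principal_ax _ _ _ y x) => //; last by rewrite lxy dual_atomK.
    apply/setP=> u; have := mS u; have := dGA u; rewrite eA !inE.
    case: (u =P x) => [->|_] /=; last by rewrite orbF.
    by rewrite (negbTE xy) => h _; apply/negP=> /h.
  + move=> dA; have eA : A = [set y].
      apply/eqP; rewrite eqEsubset; apply/andP; split.
        apply/subsetP=> u uA; have := mS u; have := dA u uA; rewrite uA orbT !inE.
        by move/negbTE => ->.
      case: cA => /set0Pn[a aA] _; have := mS a; have := dA a aA.
      by rewrite aA orbT inE => /negbTE -> /eqP e; rewrite sub1set -e.
    apply: (@principal_ax _ _ _ x y) => //.
    apply/setP=> u; have := mS u; have := dGA u; rewrite eA !inE.
    case: (u =P y) => [->|_] /=; last by rewrite !orbF.
    by rewrite eq_sym (negbTE xy) => h _; apply/negP=> /h.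
- have mS u : (u \in S1) || (u \in S2) = (u \in G) || (u \in A).
    by rewrite -!in_setU -eS.
  have dGA u : u \in G -> u \notin A by exact: (dsep_disj sGA).
  have dGD u : u \in G -> u \notin D by exact: (dsep_disj sGD).
  have dAD u : u \in A -> u \notin D by exact: (dsep_disj sAD).
  have isoA u v : u \in A -> v \in G -> edge u v = false.
    by move=> uA vG; rewrite edge_sym; apply: dual_edgeE; apply: sGA.
  have GS1 u : u \in S1 -> u \notin A -> u \in G.
    by move=> u1 uA; have := mS u; rewrite u1 (negbTE uA) orbF.
  have GS2 u : u \in S2 -> u \notin A -> u \in G.
    by move=> u1 uA; have := mS u; rewrite u1 (negbTE uA) orbF orbT.
  (* If some edge of [A] joins the two premises, then all of [M] and [R] is in [A], because [A] is
     separated from [G]: the rule is principal. *)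
  case: (boolP [exists m in M, (m \in A) && [exists r in R, r \in A]]).
    case/exists_inP=> m mM /andP[mA /exists_inP[r rR rA]].
    have MA u : u \in M -> u \in A.
      move=> uM; apply: contraT => uA.
      have := isoA r u rA (GS1 _ (sM _ uM) uA).
      by rewrite edge_sym he ?sM ?sR // uM rR.
    have RA u : u \in R -> u \in A.
      move=> uR; apply: contraT => uA.
      have := isoA m u mA (GS2 _ (sR _ uR) uA).
      by rewrite he ?sM ?sR // mM uR.
    (* [S1 :\: M] has no edge to the rest of the conclusion, so the connected [A], which meets [M],
       avoids it. *)
    have A1 u : u \in A -> u \in S1 -> u \in M.
      case: (@connected_side _ A (S1 :\: M) cA).
      + move=> v w vA wA; rewrite !inE => /andP[vM v1] hw.
        case w1: (w \in S1).
          have wM : w \in M by move: hw; rewrite w1 andbT negbK.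
          have vSM : v \in S1 :\: M by rewrite inE vM v1.
          by have := sep w v wM vSM; rewrite edge_sym => /andP[].
        have w2 : w \in S2 by have := mS w; rewrite w1 wA orbT.
        by rewrite he // (negbTE vM).
      + by move=> h; have := h m mA; rewrite inE mM.
      + by move=> h uA u1; have := h u uA; rewrite inE u1 andbT negbK.
    apply: hprin => //; last by rewrite -eS; exact: (derivable_plug dS sM sR sep he p1 p2).
    apply: (@principal_plug _ _ _ (S1 :\: M) (S2 :\: A) M) => //.
    + apply/setP=> u; rewrite !inE.
      have := mS u; have := dGA u; have := A1 u; have := MA u; have := dS u.
      solve_mem.
    + move=> u v; rewrite !inE => /andP[uM u1] /andP[vA v2].
      apply: (@dual_edge_mem _ _ S1) => //.
        by apply/negP=> /dS; rewrite v2.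
      by rewrite he // (negbTE uM).
    + by apply/set0Pn; exists m.
    + apply/eqP=> e; have := dS r; rewrite sM ?e // sR //; by move/(_ isT).
    + move=> v vA vM u u' uM u'M.
      have v2 : v \in S2.
        have := mS v; rewrite vA orbT => /orP[v1|//].
        by rewrite A1 in vM.
      by rewrite !(edge_sym v) !he ?sM // uM u'M.
    + have -> // : (S1 :\: M) :|: M = S1.
      by apply/setP=> u; rewrite !inE; have := sM u; case: (u \in M) => /= [->//|];
        rewrite orbF.
    + have -> // : (S2 :\: A) :|: (A :\: M) = S2.
      apply/setP=> u; rewrite !inE; have := mS u; have := dS u; have := A1 u; have := sM u.
      solve_mem.
  (* Otherwise no edge of [A] crosses and [A] lies in one premise. There it is exchanged for [D],
     and the rule is applied again with [A] taken out of [M] or [R]. *)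
  move=> hMR; case: (@connected_side _ A S1 cA).
  + move=> u v uA vA u1 v1.
    have v2 : v \in S2 by have := mS v; rewrite (negbTE v1) vA orbT.
    rewrite he //; apply: contra hMR => /andP[uM vR].
    by apply/exists_inP; exists u; rewrite // uA; apply/exists_inP; exists v.
  + move=> A1.
    have A2 u : u \in S2 -> u \notin A by move=> u2; apply/negP=> /A1/dS; rewrite u2.
    have G1 u : u \in S1 :\: A -> u \in G by rewrite inE => /andP[? ?]; apply: GS1.
    have G2 u : u \in S2 -> u \in G by move=> u2; apply: GS2 => //; apply: A2.
    have q1 : derivable ((S1 :\: A) :|: D).
      apply: IH1.
      * apply/setP=> u; rewrite !inE; have := A1 u; case: (u \in A) => //= [->//|];
        by rewrite orbF.
      * by move=> u v /G1; apply: sGA.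
      * by move=> u v /G1; apply: sGD.
      * by move=> u v /G1; apply: sGE.
    have -> : G :|: D = ((S1 :\: A) :|: D) :|: S2.
      apply/setP=> u; rewrite !inE; have := mS u; have := A1 u; have := A2 u; have := dGA u.
      solve_mem.
    apply: (@derivable_plug _ _ _ _ (M :\: A) R) => //.
    * move=> u; rewrite !inE => /orP[/andP[_ /dS]//|uD]; apply/negP=> /G2 /dGD; by rewrite uD.
    * by move=> u; rewrite !inE => /andP[-> /sM ->].
    * move=> u v; rewrite !inE => /andP[uA uM] /andP[h1 /orP[/andP[h2 h3]|vD]].
        by apply: sep => //; rewrite inE h3 andbT; move: h1; rewrite h2.
      by apply: sGD => //; apply: G1; rewrite inE uA sM.
    * move=> u v; rewrite !inE => /orP[/andP[uA u1]|uD] v2; first by rewrite uA he.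
      rewrite edge_sym (dual_edgeE (sGD v u (G2 _ v2) uD)).
      case uA: (u \in A) => //=; apply/esym/negbTE; rewrite negb_and; apply/orP; left.
      apply: contraL uD => uM; apply: dGD; apply: G1; by rewrite inE uA sM.
  + move=> A1.
    have A2 u : u \in A -> u \in S2.
      by move=> uA; have := mS u; rewrite (negbTE (A1 u uA)) uA orbT.
    have G1 u : u \in S1 -> u \in G by move=> u1; apply: GS1 => //; apply/negP=> /A1;
      rewrite u1.
    have G2 u : u \in S2 :\: A -> u \in G by rewrite inE => /andP[? ?]; apply: GS2.
    have q2 : derivable ((S2 :\: A) :|: D).
      apply: IH2.
      * apply/setP=> u; rewrite !inE; have := A2 u; case: (u \in A) => //= [->//|];
        by rewrite orbF.
      * by move=> u v /G2; apply: sGA.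
      * by move=> u v /G2; apply: sGD.
      * by move=> u v /G2; apply: sGE.
    have -> : G :|: D = S1 :|: ((S2 :\: A) :|: D).
      apply/setP=> u; rewrite !inE; have := mS u; have := A1 u; have := A2 u; have := dGA u.
      solve_mem.
    apply: (@derivable_plug _ _ _ _ M (R :\: A)) => //.
    * move=> u u1; rewrite !inE negb_or negb_and (dS u u1) orbT /=; apply: dGD; exact: G1.
    * by move=> u; rewrite !inE => /andP[-> /sR ->].
    * move=> u v u1; rewrite !inE => /orP[/andP[vA v2]|vD]; first by rewrite vA he.
      rewrite (dual_edgeE (sGD u v (G1 _ u1) vD)).
      case vA: (v \in A); rewrite ?andbF //=; apply/esym/negbTE; rewrite negb_and;
        apply/orP; right.
      apply: contraL vD => vR; apply: dGD; apply: G2; by rewrite inE vA sR.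
- have mS u : (u \in S) = (u \in G) || (u \in A).
    by rewrite eS in_setU.
  have dGA u : u \in G -> u \notin A by exact: (dsep_disj sGA).
  have dGD u : u \in G -> u \notin D by exact: (dsep_disj sGD).
  have dAD u : u \in A -> u \notin D by exact: (dsep_disj sAD).
  have isoA u v : u \in A -> v \in G -> edge u v = false.
    by move=> uA vG; rewrite edge_sym; apply: dual_edgeE; apply: sGA.
  have AS u : u \in A -> u \in S by rewrite mS => ->; rewrite orbT.
  have GSA u : u \in S -> u \notin A -> u \in G by rewrite mS => /orP[//|->].
  have iso X' Y' q' : coloring S X' Y' c q' -> qprime q' (c @: S) ->
      (forall i, i \in c @: S -> exists x, x \in X' /\ c x = i) ->
      {subset A <= X'} -> A = X'.
    move=> col' qp' fX' sA; apply: (qprime_isolated col' qp' fX') => //; first by case: cA.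
    by move=> u v uA vX vA; rewrite isoA // GSA // (col_X col').
  have side X' Y' q' : coloring S X' Y' c q' -> {subset A <= X'} \/ disj A X'.
    move=> col'; apply: connected_side => // u v uA vA uX vX.
    by have /andP[] := coloring_edge_sep col' (AS _ uA) (AS _ vA) uX vX.
  case: (side _ _ _ col) => [sA|dX].
    have eA := iso _ _ _ col qp fX sA; subst X S.
    apply: hprin => //; first exact: principal_prime col qp fX fY p.
    exact: derivable_prime col qp fX fY p.
  have col' := coloring_swap col; have qp' := qprime_neg qp.
  case: (side _ _ _ col') => [sA|dY].
    have eA := iso _ _ _ col' qp' fY sA; subst Y S.
    apply: hprin => //; first exact: principal_prime col' qp' fY fX p.
    exact: derivable_prime col qp fX fY p.
  (* Now [A] lies in the side context, where no edge joins different colours, so [A] is inside one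
     class. *)
  case: (cA) => /set0Pn[a aA] _; set i := c a.
  have ci : forall u, u \in A -> c u = i.
    case: (@connected_side _ A (color_class S c i) cA).
    - move=> u v uA vA; rewrite !inE (AS _ uA) (AS _ vA) /= => /eqP cu cv.
      by rewrite (col_edge col) ?AS // ?(negbTE (dX u uA)) ?(negbTE (dY u uA)) // cu eq_sym.
    - by move=> h u /h; rewrite inE => /andP[_ /eqP].
    - by move=> h; have := h a aA; rewrite inE (AS _ aA) eqxx.
  have GX u : u \in X -> u \in G.
    by move=> uX; apply: GSA; rewrite ?(col_X col) //; apply/negP=> /dX; rewrite uX.
  have GY u : u \in Y -> u \in G.
    by move=> uX; apply: GSA; rewrite ?(col_Y col) //; apply/negP=> /dY; rewrite uX.
  have q1 : derivable ((color_class S c i :\: A) :|: D).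
    have hG u : u \in color_class S c i :\: A -> u \in G.
      by rewrite !inE => /and3P[? ? _]; apply: GSA.
    apply: (IH i).
    + apply/setP=> u; rewrite !inE; have := ci u; have := AS u; case: (u \in A) => /=.
        by move=> /(_ isT) -> /(_ isT) ->; rewrite eqxx.
      by rewrite orbF.
    + by move=> u v /hG; apply: sGA.
    + by move=> u v /hG; apply: sGD.
    + by move=> u v /hG; apply: sGE.
  (* [D] takes over the colour of [A]; only the class [i] changes, and it is handled by [q1]. *)
  apply: (@derivable_coloring _ _ I q (fun u => if u \in D then i else c u) _ X Y).
  + case: (col) => qs hX hY hXY sX sY he; split=> //.
    * by move=> u /GX uG; rewrite inE uG.
    * by move=> u /GY uG; rewrite inE uG.
    * move=> u v uX; rewrite !inE => /andP[vX /orP[vG|vD]]; last by apply: sGD; first exact: GX.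
      by apply: sX => //; rewrite inE vX mS vG.
    * move=> u v uX; rewrite !inE => /andP[vX /orP[vG|vD]]; last by apply: sGD => //; apply: GY.
      by apply: sY => //; rewrite inE vX mS vG.
    * move=> u v; rewrite !inE => /orP[uG|uD] /orP[vG|vD].
      - rewrite !ifN ?dGD // => ?; apply: he => //; by rewrite mS ?uG ?vG.
      - have nX : v \notin X by apply: contraL vD => /GX; exact: dGD.
        have nY : v \notin Y by apply: contraL vD => /GY; exact: dGD.
        by rewrite (negbTE nX) (negbTE nY) !andbF (dual_edgeE (sGD u v uG vD)).
      - have nX : u \notin X by apply: contraL uD => /GX; exact: dGD.
        have nY : u \notin Y by apply: contraL uD => /GY; exact: dGD.
        by rewrite (negbTE nX) (negbTE nY) edge_sym (dual_edgeE (sGD v u vG uD)).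
      - by rewrite uD vD eqxx.
  + move=> j; case: (eqVneq j i) => [->|ji].
      have <- // : (color_class S c i :\: A) :|: D = color_class (G :|: D) (fun u =>
        if u \in D then i else c u) i.
      apply/setP=> u; rewrite !inE mS; have := dGD u; have := dAD u; have := dGA u.
      case: (u \in D); first by rewrite eqxx !orbT.
      by rewrite !orbF; case: (u \in A); case: (u \in G) => //=; try by move=> /(_ isT).
    have <- // : color_class S c j = color_class (G :|: D) (fun u =>
      if u \in D then i else c u) j.
    apply/setP=> u; rewrite !inE mS; have := dGD u; have := dAD u; have := dGA u; have := ci u.
    case: (u \in D).
      case: (u \in G) => /=; first by move=> _ _ _ /(_ isT).
      case: (u \in A) => /=; first by move=> _ _ /(_ isT).
      by move=> *; rewrite eq_sym (negbTE ji).
    rewrite orbF; case: (u \in A); last by rewrite orbF.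
    case: (u \in G) => /=; first by move=> _ /(_ isT).
    by move=> /(_ isT) ->; rewrite eq_sym (negbTE ji).
Qed.

End Principal.

(** * Replacing a module in a context by means of smaller cuts *)

Section Replacement.
Variable V : countType.
Implicit Types (T : graph V).

Lemma derivable_bij T T' (g : T -> T') (h : T' -> T) (S : {set T}) (S' : {set T'}) :
  {in S, forall x, g x \in S'} -> {in S', forall y, h y \in S} ->
  {in S, cancel g h} -> {in S', cancel h g} ->
  {in S &, forall u v, edge (g u) (g v) = edge u v} ->
  {in S, forall u, label (g u) = label u} -> derivable S -> derivable S'.
Proof.
move=> gS hS gK hK ge gl p; apply: (derivable_preim (h := h) p).
- apply/setP=> x; apply/idP/imsetP => [xS|[y yS ->]]; last exact: hS.
  by exists (g x); rewrite ?gS ?gK.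
- by move=> x y xS yS e; rewrite -(hK x xS) -(hK y yS) e.
- by move=> x y xS yS; rewrite -ge ?hS // !hK.
- by move=> x xS; rewrite -gl ?hS // hK.
Qed.

Lemma dsep_mono T (A B X Y : {set T}) :
  dsep A B -> {subset X <= A} -> {subset Y <= B} -> dsep X Y.
Proof. by move=> s sX sY x y /sX xA /sY; apply: s. Qed.

Lemma dsepUl T (A B C : {set T}) : dsep A C -> dsep B C -> dsep (A :|: B) C.
Proof. by move=> h1 h2 x y; rewrite inE => /orP[]; [apply: h1|apply: h2]. Qed.

Lemma dsepUr T (A B C : {set T}) : dsep C A -> dsep C B -> dsep C (A :|: B).
Proof. by move=> h1 h2 x y hx; rewrite inE => /orP[]; [apply: h1|apply: h2]. Qed.

Lemma dsep0r T (A : {set T}) : dsep A set0.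
Proof. by move=> x y _; rewrite inE. Qed.

Lemma dsep0l T (A : {set T}) : dsep set0 A.
Proof. by move=> x y; rewrite inE. Qed.

(** The maps are total on [T] and constrained only on [A] and [B], so the same [f] and [g] serve for
    every subset of [A] and its dual. *)
Record dualpair T (A B : {set T}) (f g : T -> T) : Prop := Dualpair {
  dp_f : {in A, forall x, f x \in B};
  dp_g : {in B, forall y, g y \in A};
  dp_fK : {in A, cancel f g};
  dp_gK : {in B, cancel g f};
  dp_lab : {in A, forall x, label (f x) = dual_atom (label x)};
  dp_edge : {in A &, forall x y, edge (f x) (f y) = dual_edge x y} }.

Record cutsep T (G A D B : {set T}) : Prop := Cutsep {
  csGA : dsep G A; csGD : dsep G D; csGB : dsep G B;
  csAD : dsep A D; csAB : dsep A B; csDB : dsep D B }.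

Definition cut_lt n : Prop := forall T (G A D B : {set T}) f g,
  #|A| < n -> dualpair A B f g -> cutsep G A D B ->
  derivable (G :|: A) -> derivable (D :|: B) -> derivable (G :|: D).

(** For a dual pair, the part of [B] that is dual to [M]. *)
Definition dual_preim (T : finType) (B : {set T}) (g : T -> T) (M : {set T}) :=
  [set y in B | g y \in M].

Lemma dualpair_sym T (A B : {set T}) f g : dualpair A B f g -> dualpair B A g f.
Proof.
case=> hf hg fK gK hl he; split=> // [y yB|x y xB yB].
  by rewrite -{2}(gK y yB) hl ?hg // dual_atomK.
rewrite {1}/dual_edge -{3}(gK x xB) -{3}(gK y yB) he ?hg // /dual_edge.
have -> : (x == y) = (g x == g y).
  by apply/eqP/eqP => [->//|e]; rewrite -(gK x xB) -(gK y yB) e.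
by case: eqP => [->|] /=; rewrite ?edge_irrefl ?negbK.
Qed.

Lemma dualpair_preim T (A B M : {set T}) f g :
  dualpair A B f g -> {subset M <= A} -> dualpair M (dual_preim B g M) f g.
Proof.
case=> hf hg fK gK hl he sM; split.
- by move=> x xM; rewrite inE hf ?sM // fK ?sM.
- by move=> y; rewrite inE => /andP[].
- by move=> x /sM; apply: fK.
- by move=> y; rewrite inE => /andP[/gK].
- by move=> x /sM; apply: hl.
- by move=> x y /sM xA /sM; apply: he.
Qed.

Lemma dualpair_card T (A B : {set T}) f g : dualpair A B f g -> #|A| = #|B|.
Proof.
case=> hf hg fK gK _ _; have -> : B = f @: A.
  apply/setP=> y; apply/idP/imsetP => [yB|[x xA ->]]; last exact: hf.
  by exists (g y); rewrite ?hg ?gK.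
by rewrite card_in_imset // => x y xA yA e; rewrite -(fK x xA) -(fK y yA) e.
Qed.

Lemma module_in_dual T (A B M : {set T}) f g :
  dualpair A B f g -> {subset M <= A} -> module_in M A -> module_in (dual_preim B g M) B.
Proof.
move=> dp sM mM v vB; rewrite inE vB /= => gvM m m'.
rewrite !inE => /andP[mB gm] /andP[m'B gm'].
have dp' := dualpair_sym dp.
have ed m0 : m0 \in B -> g m0 \in M -> edge v m0 = ~~ edge (g v) (g m0).
  move=> m0B gm0; rewrite (dp_edge dp') // /dual_edge.
  have -> : v != m0 by apply: contraNneq gvM => ->.
  by rewrite negbK.
rewrite !ed //; congr (~~ _); apply: mM => //; exact: (dp_g dp).
Qed.

Lemma dual_inlE (G H : graph V) (x y : G) :
  dual_edge (inl x : par G H) (inl y : par G H) = dual_edge x y.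
Proof. by []. Qed.

Lemma dual_inrE (G H : graph V) (x y : H) :
  dual_edge (inr x : par G H) (inr y : par G H) = dual_edge x y.
Proof. by []. Qed.

(* The cut is made on a copy of [H :|: M], against a dual copy of it together with
   a second copy of [H]: hence the ambient graph with three components. *)
Lemma replace_module n : cut_lt n -> forall T (G H M D M' N : {set T}) f g,
  #|H :|: M| < n -> dualpair M M' f g -> disj H M ->
  dsep G (H :|: M) -> dsep G D -> dsep G N ->
  dsep D M' -> dsep D N -> dsep M' N -> dsep D H -> disj N H ->
  (forall h, h \in H -> {in M :|: N &, forall m m', edge h m = edge h m'}) ->
  derivable (G :|: (H :|: M)) -> derivable (D :|: M' :|: N) -> derivable (G :|: D :|: H :|: N).
Proof.
move=> IH T G H M D M' N f g lt dp dHM sG sGD sGN sDM' sDN sM'N sDH dNH uni p1 p2.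
pose T' := par T (par (dual T) T).
pose tri (P Q R : {set T}) : {set T'} := [set w : T' | match w with
  inl x => x \in P | inr (inl x) => x \in Q | inr (inr x) => x \in R end].
have DM' := dsep_disj sDM'; have DN := dsep_disj sDN; have M'N := dsep_disj sM'N.
have DH := dsep_disj sDH; have GD := dsep_disj sGD; have GN := dsep_disj sGN.
have GHM := dsep_disj sG.
pose prj (w : T') : T := match w with inl x => x | inr (inl x) => x | inr (inr x) => x end.
pose f' (w : T') : T' := match w with inl x => inr (inl x) | _ => w end.
pose g' (w : T') : T' := match w with inr (inl x) => inl x | _ => w end.
have q1 : derivable (tri G set0 set0 :|: tri (H :|: M) set0 set0).
  apply: (derivable_bij (g := fun x => inl x : T') (h := prj) _ _ _ _ _ _ p1) => //.
  - by move=> x xS; rewrite !inE in xS *.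
  - by move=> [x|[x|x]]; rewrite !inE.
  - by move=> [x|[x|x]]; rewrite !inE.
pose r h := [exists m in M :|: N, edge h m].
have rE h m : h \in H -> m \in M :|: N -> edge h m = r h.
  move=> hH mM; apply/idP/exists_inP => [e|[m' m'M e]]; first by exists m.
  by rewrite (uni h hH m m').
(* The quotient of [H[M]] in which the module is a single vertex [None] and each vertex of [H]
   stands for itself. *)
pose I := option T.
pose q (i j : I) := match i, j with
  | Some h, Some h' => edge h h' | Some h, None => r h | None, Some h => r h
  | None, None => false end.
pose c (w : T') : I := if prj w \in H then Some (prj w) else None.
have qE x y : x \in H :|: M :|: N -> y \in H :|: M :|: N ->
   (if x \in H then Some x else None) != (if y \in H then Some y else None) ->
   edge x y = q (if x \in H then Some x else None) (if y \in H then Some y else None).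
  rewrite -setUA => xS yS; case xH: (x \in H); case yH: (y \in H) => //= _.
    by apply: rE => //; move: yS; rewrite inE yH.
  by rewrite edge_sym; apply: rE => //; move: xS; rewrite inE xH.
(* [D], the context [H] filled with [N], and the dual of [H[M]]: the class [None] is a copy of the
   second premise, the classes of vertices of [H] are axioms. *)
have q2 : derivable (tri set0 set0 (D :|: H :|: N) :|: tri set0 (H :|: M) set0).
  apply: (@derivable_coloring _ _ I q c _ (tri set0 (H :|: M) set0) (tri set0 set0 (H :|: N))).
  - split.
    + move=> [h|] [h'|] //=; by rewrite edge_sym.
    + by move=> [x|[x|x]]; rewrite !inE.
    + by move=> [x|[x|x]]; rewrite !inE // => /orP[] ->; rewrite ?orbT.
    + by move=> [x|[x|x]]; rewrite !inE.
    + by move=> [x|[x|x]] [y|[y|y]]; rewrite !inE // ?orbF => _; case: (_ || _).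
    + move=> [x|[x|x]] [y|[y|y]]; rewrite !inE // ?orbF => hx /andP[hy hy'].
      rewrite dual_inrE dual_inrE dual_sym.
      have yD : y \in D by move: hy hy'; rewrite -orbA; case: (y \in D); case: (_ || _).
      by case/orP: hx; [apply: sDH | apply: sDN].
    + move=> [x|[x|x]] [y|[y|y]]; rewrite !inE /= ?andbF ?orbF // => hx hy cxy.
      * have xy : x != y by apply: contraNneq cxy => ->.
        rewrite hx hy /dual_edge xy /= (qE x y) //.
        - by rewrite 2!inE hx.
        - by rewrite 2!inE hy.
      * rewrite /=; case xD: (x \in D).
          have xH := DH x xD; have xN := DN x xD.
          rewrite (negbTE xH) (negbTE xN) /=.
          case/orP: hy => [/orP[yD|yH]|yN].
          - by move: cxy; rewrite /c /= (negbTE xH) (negbTE (DH y yD)).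
          - exact: dual_edgeE (sDH x y xD yH).
          - exact: dual_edgeE (sDN x y xD yN).
        case yD: (y \in D).
          have xH := DH y yD; have xN := DN y yD.
          rewrite (negbTE xH) (negbTE xN) /= andbF edge_sym.
          case/orP: hx => [/orP[yD'|yH]|yN].
          - by move: xD; rewrite yD'.
          - exact: dual_edgeE (sDH y x yD yH).
          - exact: dual_edgeE (sDN y x yD yN).
        move: hx hy; rewrite xD yD /= => hx hy; rewrite hx hy /=.
        apply: qE => //; by move: hx hy; solve_mem.
  - case=> [h|].
    + case hH: (h \in H); last first.
        have -> : color_class (tri set0 set0 (D :|: H :|: N) :|: tri set0 (H :|: M) set0) c
          (Some h) = set0; last exact: derivable_nil.
        apply/setP=> w; rewrite !inE /c; case: ifP => [pH|]; rewrite ?andbF //.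
        apply/negbTE; rewrite negb_and; apply/orP; right.
        by apply/eqP=> -[e]; move: pH; rewrite e hH.
      have -> : color_class (tri set0 set0 (D :|: H :|: N) :|: tri set0 (H :|: M) set0) c
        (Some h)
          = [set (inr (inl h) : T'); (inr (inr h) : T')].
        apply/setP=> w; rewrite !inE /c; apply/idP/orP.
          case: ifP => // [pH|]; rewrite ?andbF // => /andP[hw /eqP[e]].
          case: w hw pH e => [x|[x|x]]; rewrite ?inE //= => _ _ ->;
          by [left|right].
        by case=> /eqP -> /=; rewrite hH ?inE hH ?orbT eqxx.
      by apply: derivable_ax.
    (* [M'] is realized in the dual component through [g]; [D] and [N] go to the third component. *)
    + pose ga x : T' := if x \in M' then inr (inl (g x)) else inr (inr x).
      pose ha (w : T') := match w with inl x => x | inr (inl x) => f x | inr (inr x) => x end.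
      have nM' x : x \in D :|: N -> (x \in M') = false.
        rewrite inE => /orP[/DM'/negbTE //|xN]; apply/negP=> /M'N; by rewrite xN.
      apply: (derivable_bij (g := ga) (h := ha) _ _ _ _ _ _ p2).
      * move=> x; rewrite -setUA (setUC M') setUA in_setU /ga /c; case xM: (x \in M').
          have gM := dp_g dp xM.
          rewrite !inE /= gM /= => _; rewrite orbT.
          by case: ifP => // gH; have := dHM _ gH; rewrite gM.
        rewrite orbF in_setU !inE /= => /orP[xD|xN]; last first.
          by rewrite (negbTE (dNH x xN)) xN !orbT.
        by rewrite (negbTE (DH x xD)) xD.
      * move=> [x|[x|x]]; rewrite !inE /c /= ?orbF.
        - by rewrite ?andbF.
        - case: ifP => [|_]; rewrite ?andbF //= andbT => xM.
          by rewrite (dp_f dp xM) orbT.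
        - by case: ifP => //; solve_mem.
      * move=> x xS; rewrite /ga; case xM: (x \in M') => //=.
        exact: (dp_gK dp).
      * move=> [x|[x|x]]; rewrite !inE /c /= ?orbF.
        - by rewrite ?andbF.
        - case: ifP => [|_]; rewrite ?andbF //= andbT => xM.
          by rewrite /ga (dp_f dp xM) (dp_fK dp xM).
        - case: ifP => [|_]; rewrite ?andbF //= !orbF andbT => hx.
          by rewrite /ga nM' // inE.
      * move=> x y; rewrite -setUA (setUC M') setUA !in_setU -!in_setU.
        rewrite (in_setU x (D :|: N)) (in_setU y (D :|: N)) /ga.
        case xM: (x \in M'); case yM: (y \in M'); rewrite ?orbT ?orbF => hx hy //=.
        - by rewrite -(dp_edge (dualpair_sym (dualpair_sym dp))) ?(dp_g dp) // !(dp_gK dp).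
        - move: hy; rewrite inE edge_sym => /orP[yD|yN];
          first by rewrite (dual_edgeE (sDM' y x yD xM)).
          by rewrite edge_sym (dual_edgeE (sM'N x y xM yN)).
        - move: hx; rewrite inE => /orP[yD|yN]; first by rewrite (dual_edgeE (sDM' x y yD yM)).
          by rewrite edge_sym (dual_edgeE (sM'N y x yM yN)).
      * move=> x _; rewrite /ga; case xM: (x \in M') => //=.
        by rewrite -(dp_lab dp) ?(dp_g dp) // (dp_gK dp).
have q3 : derivable (tri G set0 set0 :|: tri set0 set0 (D :|: H :|: N)).
  apply: (IH T' _ (tri (H :|: M) set0 set0) _ (tri set0 (H :|: M) set0) f' g') => //.
  - apply: leq_ltn_trans lt.
    apply: (@leq_trans #|[set (inl x : T') | x in H :|: M]|); last exact: leq_imset_card.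
    apply: subset_leq_card; apply/subsetP=> -[x|[x|x]]; rewrite !inE // => hx.
    by apply/imsetP; exists x; rewrite ?inE.
  - split.
    + by move=> [x|[x|x]]; rewrite !inE /= ?inE.
    + by move=> [x|[x|x]]; rewrite !inE /= ?inE.
    + by move=> [x|[x|x]]; rewrite !inE /= ?inE.
    + by move=> [x|[x|x]]; rewrite !inE /= ?inE.
    + by move=> [x|[x|x]]; rewrite !inE /= ?inE.
    + by move=> [x|[x|x]] [y|[y|y]]; rewrite !inE /= ?inE.
  - split; move=> [x|[x|x]] [y|[y|y]]; rewrite !inE // => hx hy.
    by rewrite dual_inlE; apply: sG; rewrite ?inE.
apply: (derivable_bij (g := prj) (h := fun x => if x \in G then inl x : T' else inr (inr x))
  _ _ _ _ _ _ q3).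
- by move=> [x|[x|x]]; rewrite !inE /= ?orbF; solve_mem.
- move=> x; rewrite !inE -!orbA; case xG: (x \in G); rewrite !inE ?xG //=.
  by rewrite orbA.
- move=> [x|[x|x]]; rewrite !inE //= ?orbF; first by move=> ->.
  case xG: (x \in G) => // h; exfalso; move: h; rewrite (negbTE (GD x xG)) (negbTE (GN x xG))
    orbF /=.
  by have := GHM x xG; rewrite inE => /norP[/negbTE ->].
- by move=> x; case: (x \in G).
- move=> [x|[x|x]] [y|[y|y]]; rewrite !inE //= ?orbF // => hx hy.
  + apply: dual_edgeE; case/orP: hy => [/orP[yD|yH]|yN]; [exact: sGD| |exact: sGN].
    by apply: sG; rewrite // inE yH.
  + rewrite edge_sym; apply: dual_edgeE; case/orP: hx => [/orP[yD|yH]|yN];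
    [exact: sGD| |exact: sGN].
    by apply: sG; rewrite // inE yH.
- by move=> [x|[x|x]]; rewrite !inE.
Qed.

End Replacement.

Ltac solve_dsep := repeat first [exact: dsep0r | exact: dsep0l | apply: dsepUl | apply: dsepUr];
  match goal with H : dsep ?A ?B |- dsep ?X ?Y =>
    first [ solve [apply: (dsep_mono H); solve_subset]
          | solve [apply: dsep_sym; apply: (dsep_mono H); solve_subset] ] end.

Ltac setext := apply/setP; let u := fresh "u" in move=> u; rewrite ?inE;
  repeat (match goal with H : {subset ?X <= ?Y} |- _ => move: (H u); clear H end);
  solve_mem.

(** * Principal cuts between two plug rules *)

Section CutPlug.
Variable V : countType.
Implicit Types (T : graph V).

Lemma sub_proper_card (T : finType) (M A : {set T}) n :
  {subset M <= A} -> M != A -> #|A| <= n -> #|M| < n.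
Proof.
move=> sM MA; apply: leq_trans; apply: proper_card.
by rewrite properEneq MA; apply/subsetP.
Qed.

Lemma setD_neq (T : finType) (M A : {set T}) :
  {subset M <= A} -> M != set0 -> A :\: M != A.
Proof.
move=> sM /set0Pn[m mM]; apply/eqP=> e; have := sM m mM.
by rewrite -e inE mM.
Qed.

Lemma setD_proper_card (T : finType) (M A : {set T}) n :
  {subset M <= A} -> M != set0 -> #|A| <= n -> #|A :\: M| < n.
Proof.
move=> sM M0; apply: sub_proper_card; last exact: setD_neq.
by move=> u; rewrite inE => /andP[].
Qed.

Lemma dual_preim_card T (A B M : {set T}) f g : dualpair A B f g -> {subset M <= A} ->
  #|dual_preim B g M| = #|M|.
Proof. by move=> dp sM; rewrite -(dualpair_card (dualpair_preim dp sM)). Qed.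

(* With [X = M \ M2], [Y = M /\ M2], [Z = M2 \ M] and [O] the rest of [A], the modules
   [M] and [M2] are disjoint or else [X] and [Z] are attached to [O] in the same way;
   in the second case [X] is replaced by the dual of [Z]. *)
Lemma cut_plug_plug n : cut_lt V n ->
  forall T (G1 G2 A D1 D2 B M M2 : {set T}) f g,
  #|A| <= n -> dualpair A B f g -> cutsep (G1 :|: G2) A (D1 :|: D2) B ->
  dsep G1 G2 -> dsep D1 D2 ->
  {subset M <= A} -> M != set0 -> M != A -> module_in M A ->
  {subset M2 <= A} -> M2 != set0 -> M2 != A -> module_in M2 A ->
  derivable (G1 :|: M) -> derivable (G2 :|: (A :\: M)) ->
  derivable (D1 :|: dual_preim B g M2) -> derivable (D2 :|: dual_preim B g (A :\: M2)) ->
  derivable ((G1 :|: G2) :|: (D1 :|: D2)).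
Proof.
move=> IH T G1 G2 A D1 D2 B M M2 f g An dp [sGA sGD sGB sAD sAB sDB] sG12 sD12
  sM M0 MA mM sM2 M20 M2A mM2 pG1 pG2 pD1 pD2.
have gB : {subset B <= g @^-1: A} by move=> u uB; rewrite inE (dp_g dp).
have cM : #|A :\: M| < n by apply: setD_proper_card.
have cM2 : #|A :\: M2| < n by apply: setD_proper_card.
have kM : #|M| < n by apply: sub_proper_card An.
have kM2 : #|M2| < n by apply: sub_proper_card An.
pose O := A :\: M :\: M2.
have sO : {subset O <= A} by solve_subset.
have dps := dualpair_sym dp.
have cO : #|O| < n.
  by apply: leq_ltn_trans cM; apply: subset_leq_card; apply: subsetDl.
have mN := module_in_dual dp sM mM; have mN2 := module_in_dual dp sM2 mM2.
case: (set_0Vmem (M :&: M2)) => [Y0|[y]].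
  have dMM u : u \in M -> u \notin M2.
    by move=> uM; apply/negP=> uM2; have := in_set0 u; rewrite -Y0 inE uM uM2.
  (* With [N] empty, replacement deletes a module: [M2] from [A :\: M] here, and dually [M] from
     [A :\: M2] below. A cut on [O] remains. *)
  have p1 : derivable (G2 :|: D1 :|: O :|: set0).
    apply: (@replace_module _ n IH T G2 O M2 D1 (dual_preim B g M2) set0 f g).
    - by apply: leq_ltn_trans cM; apply: subset_leq_card; apply/subsetP=> u;
      move: (dMM u) (sM2 u); solve_mem.
    - exact: dualpair_preim dp sM2.
    - by move=> u; solve_mem.
    - by solve_dsep.
    - by solve_dsep.
    - by solve_dsep.
    - by solve_dsep.
    - by solve_dsep.
    - by solve_dsep.
    - by solve_dsep.
    - by move=> u; rewrite inE.
    - by rewrite setU0 => h; rewrite !inE => /and3P[h1 h2 h3]; apply: mM2.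
    - suff -> : O :|: M2 = A :\: M by [].
      by apply/setP=> u; move: (dMM u) (sM2 u); solve_mem.
    - by rewrite setU0.
  have p2 : derivable (D2 :|: G1 :|: dual_preim B g O :|: set0).
    apply: (@replace_module _ n IH T D2 (dual_preim B g O) (dual_preim B g M) G1 M set0 g f).
    - apply: leq_ltn_trans cM2; rewrite -(dual_preim_card dp (M := A :\: M2));
      last by solve_subset.
      by apply: subset_leq_card; apply/subsetP=> u; move: (dMM (g u)) (sM (g u)); solve_mem.
    - by apply: dualpair_sym; exact: dualpair_preim dp sM.
    - by move=> u; solve_mem.
    - by solve_dsep.
    - by solve_dsep.
    - by solve_dsep.
    - by solve_dsep.
    - by solve_dsep.
    - by solve_dsep.
    - by solve_dsep.
    - by move=> u; rewrite inE.
    - rewrite setU0 => h; rewrite !inE => /andP[hB /and3P[h1 h2 h3]]; apply: mN => //.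
      by rewrite inE hB.
    - suff -> : dual_preim B g O :|: dual_preim B g M = dual_preim B g (A :\: M2) by [].
      by apply/setP=> u; move: (dMM (g u)) (sM (g u)); solve_mem.
    - by rewrite setU0.
  rewrite !setU0 in p1 p2.
  have := IH T (G2 :|: D1) O (D2 :|: G1) (dual_preim B g O) f g cO (dualpair_preim dp sO) _
    p1 p2.
  have -> : (G2 :|: D1) :|: (D2 :|: G1) = (G1 :|: G2) :|: (D1 :|: D2) by setext.
  by apply; split; solve_dsep.
rewrite inE => /andP[yM yM2].
pose X := M :\: M2; pose Y := M :&: M2; pose Z := M2 :\: M.
have yB : f y \in B by apply: (dp_f dp); apply: sM.
have gyE : g (f y) = y by apply: (dp_fK dp); apply: sM.
have sX : {subset X <= A} by solve_subset.
have sY : {subset Y <= A} by solve_subset.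
have sZ : {subset Z <= A} by solve_subset.
(* In effect a cut on [Y], the common part of [M] and [M2]. On one of the two sides [Y] must be
   separated from its remainder; which side it is depends on the edges between [X] and [Y]. *)
have pW : derivable (G1 :|: D1 :|: X :|: dual_preim B g Z).
  case: (boolP [exists x in X, [exists y' in Y, edge x y']]) => [|hXY].
    case/exists_inP=> x; rewrite inE => /andP[xM2 xM] /exists_inP[y'].
    rewrite inE => /andP[y'M y'M2] exy.
    (* Outside [M2], [x] sees a vertex of [M2] and hence all of [Z]; outside [M], each vertex of [Z]
       sees [x] and hence all of [Y]. In the dual, [Z] and [Y] are therefore separated. *)
    have sZY : dsep (dual_preim B g Z) (dual_preim B g Y).
      move=> z v; rewrite !inE => /and3P[zB zM zM2] /and3P[vB vM vM2].
      apply: (@dual_edge_mem _ _ (B :\: dual_preim B g M)); rewrite ?inE ?zB ?vB ?vM //=.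
        by rewrite (negbTE zM).
      have exz : edge x (g z) by rewrite (mM2 x (sM x xM) xM2 (g z) y').
      have -> : edge z v = dual_edge (g z) (g v).
        by rewrite -(dp_edge (dualpair_sym dps)) ?(dp_g dp) // !(dp_gK dp).
      rewrite /dual_edge negb_and negbK; apply/orP; right.
      by rewrite (mM (g z) (sM2 _ zM2) zM (g v) x) // edge_sym exz.
    have -> : G1 :|: D1 :|: X :|: dual_preim B g Z = G1 :|: (D1 :|: dual_preim B g Z) :|: X
      :|: set0.
      by rewrite setU0 -!setUA (setUC X) !setUA.
    apply: (@replace_module _ n IH T G1 X Y (D1 :|: dual_preim B g Z) (dual_preim B g Y) set0
      f g).
    - by rewrite /X /Y setUC setID.
    - exact: (dualpair_preim dp sY).
    - by move=> u; rewrite !inE => /andP[/negbTE -> ->].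
    - by solve_dsep.
    - by solve_dsep.
    - by solve_dsep.
    - by solve_dsep.
    - by solve_dsep.
    - by solve_dsep.
    - by solve_dsep.
    - by move=> u; rewrite inE.
    - rewrite setU0 => h; rewrite !inE => /andP[h1 h2] m m';
      rewrite !inE => /andP[? ?] /andP[? ?].
      by apply: mM2 => //; apply: sM.
    - by rewrite (_ : X :|: Y = M) // /X /Y setUC setID.
    - rewrite setU0 (_ : _ :|: _ = D1 :|: dual_preim B g M2) //.
      by apply/setP=> u; rewrite !inE; case: (u \in D1) => //=; case: (u \in B) => //=;
        case: (g u \in M); case: (g u \in M2).
  have sXY : dsep X Y.
    move=> x v xX vY; apply: (@dual_edge_mem _ _ (A :\: M2)).
    - by move: xX; rewrite !inE => /andP[-> /sM ->].
    - by move: vY; rewrite !inE => /andP[_ ->].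
    - by apply: contra hXY => e; apply/exists_inP; exists x => //; apply/exists_inP; exists v.
  have -> : G1 :|: D1 :|: X :|: dual_preim B g Z = D1 :|: (G1 :|: X) :|: dual_preim B g Z :|:
    set0.
    by rewrite setU0 !setUA (setUC D1).
  apply: (@replace_module _ n IH T D1 (dual_preim B g Z) (dual_preim B g Y) (G1 :|: X) Y set0
    g f).
  - rewrite (_ : _ :|: _ = dual_preim B g M2) ?(dual_preim_card dp sM2) //.
    by apply/setP=> u; rewrite !inE; case: (u \in B) => //=; case: (g u \in M);
      case: (g u \in M2).
  - by apply: dualpair_sym; exact: (dualpair_preim dp sY).
  - by move=> u; rewrite !inE => /and3P[-> /negbTE -> ->].
  - by solve_dsep.
  - by solve_dsep.
  - by solve_dsep.
  - by solve_dsep.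
  - by solve_dsep.
  - by solve_dsep.
  - by solve_dsep.
  - by move=> u; rewrite inE.
  - rewrite setU0 => h; rewrite !inE => /and3P[h1 h2 h3] m m';
    rewrite !inE => /and3P[? ? ?] /and3P[? ? ?].
    by apply: mN; rewrite ?inE ?h1 //; apply/andP; split.
  - rewrite (_ : dual_preim B g Z :|: dual_preim B g Y = dual_preim B g M2) //.
    by apply/setP=> u; rewrite !inE; case: (u \in B) => //=; case: (g u \in M);
      case: (g u \in M2).
  - by rewrite setU0 -setUA (_ : X :|: Y = M) // /X /Y setUC setID.
(* From [O], both [X] and [Z] look like [y], the former through [M] and the latter through [M2].
   Replacing the dual of [X] by that of [Z] turns the dual of [A :\: M2] into that of [A :\: M],
   which is cut against [G2, A :\: M]. *)
have p2 : derivable (D2 :|: (G1 :|: D1) :|: dual_preim B g O :|: dual_preim B g Z).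
  apply: (@replace_module _ n IH T D2 (dual_preim B g O) (dual_preim B g X) (G1 :|: D1) X
    (dual_preim B g Z) g f).
  - rewrite (_ : _ :|: _ = dual_preim B g (A :\: M2));
    first by rewrite (dual_preim_card dp) //; solve_subset.
    apply/setP=> u; rewrite !inE; move: (sM (g u)).
    by case: (u \in B) => //=; case: (g u \in M) => //= [->//|_]; case: (g u \in M2);
      rewrite ?orbF.
  - by apply: dualpair_sym; exact: (dualpair_preim dp sX).
  - by move=> u; rewrite !inE => /and4P[-> _ /negbTE ->]; rewrite andbF.
  - by solve_dsep.
  - by solve_dsep.
  - by solve_dsep.
  - by solve_dsep.
  - by solve_dsep.
  - by solve_dsep.
  - by solve_dsep.
  - by move=> u; rewrite !inE => /and3P[_ _ ->]; rewrite andbF.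
  - move=> h; rewrite !inE => /and4P[hB hM2 hM hA].
    have key m : m \in dual_preim B g X :|: dual_preim B g Z -> edge h m = edge h (f y).
      rewrite !inE => /orP[/and3P[mB mM2' mM']|/and3P[mB mM' mM2']].
        by apply: mN; rewrite ?inE ?hB ?mB ?yB ?gyE.
      by apply: mN2; rewrite ?inE ?hB ?mB ?yB ?gyE.
    by move=> m m' hm hm'; rewrite !key.
  - rewrite (_ : dual_preim B g O :|: dual_preim B g X = dual_preim B g (A :\: M2)) //.
    apply/setP=> u; rewrite !inE; move: (sM (g u)).
    by case: (u \in B) => //=; case: (g u \in M) => //= [->//|_]; case: (g u \in M2);
      rewrite ?orbF.
  - by [].
have sAM : {subset A :\: M <= A} by solve_subset.
have := IH T G2 (A :\: M) (D2 :|: (G1 :|: D1)) (dual_preim B g (A :\: M)) f g cM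
  (dualpair_preim dp sAM) _ pG2.
have -> : G2 :|: (D2 :|: (G1 :|: D1)) = (G1 :|: G2) :|: (D1 :|: D2).
  by rewrite !setUA (setUC G1) -!setUA; congr (_ :|: _); rewrite setUCA (setUC D2).
apply; first by split; solve_dsep.
rewrite (_ : dual_preim B g (A :\: M) = dual_preim B g O :|: dual_preim B g Z) ?setUA //;
  first by rewrite -!setUA in p2 *.
apply/setP=> u; rewrite !inE; move: (sM2 (g u)).
by solve_mem.
Qed.

End CutPlug.

(** * Principal cuts involving the prime rule *)

Section CutPrime.
Variable V : countType.
Implicit Types (T : graph V).

Lemma dual_preim_eq (T : finType) (B : {set T}) g (M : {set T}) u :
  (u \in dual_preim B g M) = (u \in B) && (g u \in M).
Proof. by rewrite inE. Qed.

(** The dual [M'] of [M] is a proper module of [B], so it lies in a single class [k]. It is deleted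
    from that premise against [G1, M]; the rule is then reapplied, and a cut on [A :\: M] against
    [G2] remains. *)
Lemma cut_plug_prime n : cut_lt V n ->
  forall T (G1 G2 A D B M : {set T}) f g (I : finType) (q : rel I) (c : T -> I) (Y : {set T}),
  #|A| <= n -> dualpair A B f g -> cutsep (G1 :|: G2) A D B -> dsep G1 G2 ->
  {subset M <= A} -> M != set0 -> M != A -> module_in M A ->
  derivable (G1 :|: M) -> derivable (G2 :|: (A :\: M)) ->
  coloring (D :|: B) B Y c q -> qprime q (c @: (D :|: B)) ->
  (forall i, i \in c @: (D :|: B) -> exists x, x \in B /\ c x = i) ->
  (forall i, derivable (color_class (D :|: B) c i)) ->
  derivable ((G1 :|: G2) :|: D).
Proof.
move=> IH T G1 G2 A D B M f g I q c Y An dp [sGA sGD sGB sAD sAB sDB] sG12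
  sM M0 MA mM pG1 pG2 col qp fX p.
have gB : forall u, u \in B -> g u \in A by move=> u uB; rewrite (dp_g dp).
have mM' := module_in_dual dp sM mM.
pose M' := dual_preim B g M.
have sM' : {subset M' <= B} by move=> u; rewrite inE => /andP[].
have M'B : M' != B.
  apply: contraNneq MA => e; rewrite eqEsubset; apply/andP; split; first exact/subsetP.
  apply/subsetP=> x xA; have := dp_f dp xA; rewrite -e inE => /andP[_].
  by rewrite (dp_fK dp).
have sc := qprime_module col qp fX sM' M'B mM'.
case/set0Pn: (M0) => m mM0.
have fmM : f m \in M' by rewrite inE (dp_f dp) ?sM // (dp_fK dp) ?sM.
pose k := c (f m).
have ck u : u \in M' -> c u = k by move=> uM; apply: sc.
pose Dk := D :&: color_class (D :|: B) c k; pose Bk := B :&: color_class (D :|: B) c k.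
have sBk : {subset Bk <= B} by move=> u; rewrite inE => /andP[].
have sDk : {subset Dk <= D} by move=> u; rewrite inE => /andP[].
have M'k u : u \in M' -> u \in Bk.
  by move=> uM; rewrite !inE sM' // ck // eqxx orbT.
have Bkc : #|Bk| < n.
  have [i iK ik] : exists2 i, i \in c @: (D :|: B) & i != k.
    case: qp => K4 _; have : 0 < #|c @: (D :|: B) :\ k|.
      rewrite -(leq_add2l (k \in c @: (D :|: B))) -cardsD1 addn1.
      apply: leq_trans K4; by case: (_ \in _).
    by case/card_gt0P=> i; rewrite !inE => /andP[ik iK]; exists i.
  case: (fX i iK) => x [xB cx].
  apply: (@sub_proper_card _ Bk B) => //; last by rewrite -(dualpair_card dp).
  apply/eqP=> e; move: xB; rewrite -e !inE cx (negbTE ik) !andbF //.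
pose H := Bk :\: M'.
have sH : {subset H <= B} by move=> u; rewrite inE => /andP[_ /sBk].
have pk : derivable (Dk :|: G1 :|: H :|: set0).
  apply: (@replace_module _ n IH T Dk H M' G1 M set0 g f).
  - rewrite (_ : H :|: M' = Bk) //.
    by apply/setP=> u; rewrite in_setU in_setD; move: (M'k u); case: (u \in M');
      case: (u \in Bk) => //; solve_bool.
  - by apply: dualpair_sym; exact: (dualpair_preim dp sM).
  - by move=> u; rewrite in_setD => /andP[].
  - apply: dsepUr; [exact: (dsep_mono sDB sDk sH) | exact: (dsep_mono sDB sDk sM')].
  - by apply: (dsep_mono (dsep_sym sGD) sDk); solve_subset.
  - exact: dsep0r.
  - by apply: (dsep_mono sGA) => //; solve_subset.
  - exact: dsep0r.
  - exact: dsep0r.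
  - by apply: (dsep_mono sGB _ sH); solve_subset.
  - by move=> u; rewrite inE.
  - rewrite setU0 => h; rewrite in_setD => /andP[h1 h2]; apply: mM' => //; exact: sBk.
  - rewrite (_ : H :|: M' = Bk); first by rewrite /Dk /Bk -setIUl setIC (setIidPl _) //;
    apply/subsetP=> u; rewrite inE => /andP[].
    by apply/setP=> u; rewrite in_setU in_setD; move: (M'k u); case: (u \in M');
      case: (u \in Bk) => //; solve_bool.
  - by rewrite setU0.
rewrite setU0 in pk.
have DG1 : disj D G1 by apply: dsep_disj; apply: dsep_sym; apply: (dsep_mono sGD) => //;
  solve_subset.
have BG1 : disj B G1 by apply: dsep_disj; apply: dsep_sym; apply: (dsep_mono sGB) => //;
  solve_subset.
have sGD1 : dsep G1 D by apply: (dsep_mono sGD) => //; solve_subset.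
have sGB1 : dsep G1 B by apply: (dsep_mono sGB) => //; solve_subset.
have YD u : u \in Y -> u \in D.
  move=> uY; have := col_Y col uY; rewrite inE => /orP[//|uB].
  by have := col_XY col uB; rewrite uY.
have nB u : u \in G1 -> (u \in B) = false by move=> uG; apply/negP=> /BG1; rewrite uG.
have nY u : u \in G1 -> (u \in Y) = false by move=> uG; apply/negP=> /YD/DG1; rewrite uG.
have nG u : u \in D :|: (B :\: M') -> (u \in G1) = false.
  by rewrite in_setU in_setD => /orP[/DG1/negbTE//|/andP[_ /BG1/negbTE]].
have pD : derivable (D :|: G1 :|: (B :\: M')).
  (* [G1] becomes side context of the class [k]. The [B] part of that class may have vanished, which
     [derivable_coloring] tolerates. *)
  pose c1 u := if u \in G1 then k else c u.
  apply: (@derivable_coloring _ T I q c1 _ (B :\: M') Y).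
  - split; first exact: (col_sym col).
    + by move=> u uB; rewrite in_setU uB orbT.
    + by move=> u /YD uD; rewrite !in_setU uD.
    + by move=> u; rewrite in_setD => /andP[_ /(col_XY col)].
    + move=> u v; rewrite in_setD => /andP[uM uB]; rewrite in_setD !in_setU => /andP[vB].
      rewrite (negbTE vB) orbF => /orP[vD|vG]; [exact: (dsep_sym sDB)|exact: (dsep_sym sGB1)].
    + move=> u v uY; rewrite in_setD !in_setU -orbA => /andP[vY /or3P[vD|vG|vB]].
      * by apply: (col_sepY col); rewrite // in_setD vY in_setU vD.
      * by apply: (dsep_sym sGD1); rewrite ?YD.
      * by apply: sDB; [exact: YD | move: vB; rewrite in_setD => /andP[]].
    + move=> u v; rewrite (setUAC D G1) (in_setU u (D :|: _)) (in_setU v (D :|: _)).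
      move=> /orP[hu|uG] /orP[hv|vG].
      * rewrite /c1 !nG // => cuv; rewrite !in_setD (col_edge col) //.
        - move: hu hv cuv; rewrite !in_setU !in_setD.
          have e w : w \in D -> (w \in B) = false by move=> wD; have := dsep_disj sDB wD;
            move/negbTE.
          by move=> /orP[/e ->|/andP[-> _]] /orP[/e ->|/andP[-> _]]; rewrite ?andbF.
        - by move: hu; rewrite !in_setU in_setD => /orP[->//|/andP[_ ->]]; rewrite orbT.
        - by move: hv; rewrite !in_setU in_setD => /orP[->//|/andP[_ ->]]; rewrite orbT.
      * move=> _; rewrite !in_setD (nB v) // (nY v) // !andbF edge_sym; apply: dual_edgeE.
        move: hu; rewrite in_setU in_setD => /orP[uD|/andP[_ uB]]; [exact: sGD1|exact: sGB1].
      * move=> _; rewrite !in_setD (nB u) // (nY u) // !andbF; apply: dual_edgeE.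
        move: hv; rewrite in_setU in_setD => /orP[uD|/andP[_ uB]]; [exact: sGD1|exact: sGB1].
      * by rewrite /c1 uG vG eqxx.
  - move=> i; case: (eqVneq i k) => [->|ik].
      rewrite (_ : color_class _ c1 k = Dk :|: G1 :|: H) //.
      apply/setP=> u; rewrite !inE /c1.
      case uG: (u \in G1); first by rewrite eqxx !orbT.
      by case: (c u == k); case: (u \in D); case: (u \in B); case: (g u \in M).
    rewrite (_ : color_class _ c1 i = color_class (D :|: B) c i) //.
    apply/setP=> u; have := ck u; rewrite !inE /c1 => cku.
    case uG: (u \in G1).
      rewrite eq_sym (negbTE ik) andbF nB //.
      by case uD: (u \in D) => //; have := DG1 u uD; rewrite uG.
    case uM: ((u \in B) && (g u \in M)); last by rewrite orbF.
    by rewrite cku // eq_sym (negbTE ik) !andbF.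
have dA : dualpair (A :\: M) (dual_preim B g (A :\: M)) f g.
  by apply: (dualpair_preim dp); solve_subset.
have eB : dual_preim B g (A :\: M) = B :\: M'.
  apply/setP=> u; rewrite in_setD !dual_preim_eq in_setD; move: (gB u).
  by case: (u \in B) => //= ->; rewrite // andbT.
rewrite (setUC G1 G2) -setUA (setUC G1 D).
apply: (IH T G2 (A :\: M) (D :|: G1) (B :\: M') f g) => //.
- exact: setD_proper_card.
- by rewrite -eB.
- by split; solve_dsep.
Qed.

(** A colour class of [A] is a module, and its dual is a proper module of [B]; hence it has one
    colour there. *)
Lemma same_color T (G A D B : {set T}) f g (I I' : finType) (q : rel I) (q' : rel I')
    c c' (Y Y' : {set T}) :
  dualpair A B f g ->
  coloring (G :|: A) A Y c q -> qprime q (c @: (G :|: A)) ->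
  (forall i, i \in c @: (G :|: A) -> exists x, x \in A /\ c x = i) ->
  coloring (D :|: B) B Y' c' q' -> qprime q' (c' @: (D :|: B)) ->
  (forall i, i \in c' @: (D :|: B) -> exists x, x \in B /\ c' x = i) ->
  {in A &, forall a b, c a = c b -> c' (f a) = c' (f b)}.
Proof.
move=> dp col qp fX col' qp' fX' a b aA bA cab.
pose M := [set x in A | c x == c a].
have sM : {subset M <= A} by move=> u; rewrite inE => /andP[].
have mM : module_in M A.
  move=> v vA; rewrite inE vA /= => cv m m'.
  rewrite !inE => /andP[mA /eqP cm] /andP[m'A /eqP cm'].
  have AS u : u \in A -> u \in G :|: A by move=> uA; rewrite inE uA orbT.
  by rewrite !(col_edge col) ?AS ?cm ?cm' // vA mA m'A (negbTE (col_XY col vA)).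
have MA : dual_preim B g M != B.
  apply/eqP=> e.
  have [i iK ik] : exists2 i, i \in c @: (G :|: A) & i != c a.
    case: qp => K4 _; have : 0 < #|c @: (G :|: A) :\ c a|.
      rewrite -(leq_add2l (c a \in c @: (G :|: A))) -cardsD1 addn1.
      apply: leq_trans K4; by case: (_ \in _).
    by case/card_gt0P=> i; rewrite !inE => /andP[ik iK]; exists i.
  case: (fX i iK) => x [xA cx]; have := dp_f dp xA.
  by rewrite -e !inE (dp_fK dp) // cx (negbTE ik) !andbF.
have sM' : {subset dual_preim B g M <= B} by move=> u; rewrite inE => /andP[].
apply: (qprime_module col' qp' fX' sM' MA (module_in_dual dp sM mM)).
  by rewrite !inE (dp_f dp) // (dp_fK dp) // aA eqxx.
by rewrite !inE (dp_f dp) // (dp_fK dp) // bA cab eqxx.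
Qed.

(** The classes of [A] and [B] match and [q'] is the negation of [q] on distinct matching colours.
    So [Y] and [Y'] are compositions over dual quotients, the conclusion is coloured again, and its
    premises are cuts between matching classes. *)
Lemma cut_prime_prime n : cut_lt V n ->
  forall T (G A D B : {set T}) f g (I I' : finType) (q : rel I) (q' : rel I')
    (c : T -> I) (c' : T -> I') (Y Y' : {set T}),
  #|A| <= n -> dualpair A B f g -> cutsep G A D B ->
  coloring (G :|: A) A Y c q -> qprime q (c @: (G :|: A)) ->
  (forall i, i \in c @: (G :|: A) -> exists x, x \in A /\ c x = i) ->
  (forall i, derivable (color_class (G :|: A) c i)) ->
  coloring (D :|: B) B Y' c' q' -> qprime q' (c' @: (D :|: B)) ->
  (forall i, i \in c' @: (D :|: B) -> exists x, x \in B /\ c' x = i) ->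
  (forall i, derivable (color_class (D :|: B) c' i)) ->
  derivable (G :|: D).
Proof.
move=> IH T G A D B f g I I' q q' c c' Y Y' An dp [sGA sGD sGB sAD sAB sDB]
  col qp fX p col' qp' fX' p'.
have dps := dualpair_sym dp.
have sc := same_color dp col qp fX col' qp' fX'.
have sc' := same_color dps col' qp' fX' col qp fX.
have sc2 a b : a \in A -> b \in A -> (c a == c b) = (c' (f a) == c' (f b)).
  move=> aA bA; apply/eqP/eqP; first exact: sc.
  by move/(sc' _ _ (dp_f dp aA) (dp_f dp bA)); rewrite !(dp_fK dp).
have gB : forall u, u \in B -> g u \in A by move=> u uB; rewrite (dp_g dp).
pose rep u := odflt u [pick a in A | c a == c u].
have repP u : u \in G -> rep u \in A /\ c (rep u) = c u.
  move=> uG; have cu : c u \in c @: (G :|: A) by apply: imset_f; rewrite inE uG.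
  rewrite /rep; case: pickP => [a /andP[aA /eqP ca] //|h].
  by case: (fX _ cu) => x [xA cx]; have := h x; rewrite xA cx eqxx.
have GD := dsep_disj sGD; have GA := dsep_disj sGA; have DB := dsep_disj sDB.
have DG := dsep_disj (dsep_sym sGD).
have YG u : u \in Y -> u \in G.
  move=> uY; have := col_Y col uY; rewrite inE => /orP[//|uB].
  by have := col_XY col uB; rewrite uY.
have YD u : u \in Y' -> u \in D.
  move=> uY; have := col_Y col' uY; rewrite inE => /orP[//|uB].
  by have := col_XY col' uB; rewrite uY.
(* A vertex of [G] is recoloured through a vertex of [A] of its old colour, which exists because
   every colour occurs in [A]. *)
pose d u := if u \in D then c' u else c' (f (rep u)).
have nD u : u \in G -> (u \in D) = false by move/GD/negbTE.
have nG u : u \in D -> (u \in G) = false by move/DG/negbTE.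
have nY u : u \in D -> (u \in Y) = false by move=> uD; apply/negP=> /YG; rewrite nG.
have nY' u : u \in G -> (u \in Y') = false by move=> uD; apply/negP=> /YD; rewrite nD.
apply: (@derivable_coloring _ T I' q' d _ Y Y').
- split; first exact: (col_sym col').
  + by move=> u /YG uG; rewrite inE uG.
  + by move=> u /YD uD; rewrite inE uD orbT.
  + by move=> u /YG uG; rewrite nY'.
  + move=> u v uY; rewrite in_setD in_setU => /andP[vY /orP[vG|vD]].
      by apply: (col_sepY col); rewrite // in_setD vY in_setU vG.
    by apply: sGD; rewrite ?YG.
  + move=> u v uY; rewrite in_setD in_setU => /andP[vY /orP[vG|vD]].
      by apply: (dsep_sym sGD); rewrite ?YD.
    by apply: (col_sepY col'); rewrite // in_setD vY in_setU vD.
  + move=> u v; rewrite !in_setU => /orP[uG|uD] /orP[vG|vD]; rewrite /d.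
    * rewrite !nD // !nY' // orbF => duv.
      have [aA ca] := repP u uG; have [bA cb] := repP v vG.
      have cab : c (rep u) != c (rep v) by rewrite sc2.
      have e1 : edge (rep u) (rep v) = ~~ q (c u) (c v).
        rewrite (col_edge col) ?in_setU ?aA ?bA ?orbT //= ca cb.
        by rewrite (negbTE (col_XY col aA)) orbF.
      have e2 : edge (f (rep u)) (f (rep v)) = ~~ q' (c' (f (rep u))) (c' (f (rep v))).
        rewrite (col_edge col') ?in_setU ?(dp_f dp) ?orbT //=.
        by rewrite (negbTE (col_XY col' (dp_f dp aA))) orbF.
      have ab : rep u != rep v by apply: contraNneq cab => ->.
      rewrite -e2 (dp_edge dp) // /dual_edge ab e1 negbK.
      rewrite (col_edge col) ?in_setU ?uG ?vG -?ca -?cb //.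
      by rewrite (negbTE (GA u uG)).
    * by move=> _; rewrite (nY v) // (nY' u) // !andbF; apply: dual_edgeE; apply: sGD.
    * by move=> _; rewrite (nY u) // (nY' v) // !andbF; apply: dual_edgeE;
      apply: (dsep_sym sGD).
    * rewrite uD vD !nY //= => cuv; rewrite (col_edge col') ?in_setU ?uD ?vD //.
      by rewrite (negbTE (DB u uD)).
- move=> i; case: (boolP [exists y in B, c' y == i]) => [/exists_inP[y yB /eqP cy]|hi];
  last first.
    have hi' y : y \in B -> c' y != i by move/exists_inPn: hi; apply.
    rewrite (_ : color_class _ _ _ = set0); first exact: derivable_nil.
    apply/setP=> u; rewrite in_set0 in_set in_setU; apply/negP=> /andP[/orP[uG|uD]]; rewrite /d.
      have [aA _] := repP u uG.
      by rewrite nD // (negbTE (hi' _ (dp_f dp aA))).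
    rewrite uD => /eqP cu.
    have /fX'[x [xB cx]] : c' u \in c' @: (D :|: B) by apply: imset_f; rewrite in_setU uD.
    by have := hi' x xB; rewrite cx cu eqxx.
  pose a := g y; have aA : a \in A := dp_g dp yB.
  have cfa : c' (f a) = i by rewrite (dp_gK dp).
  pose Ai := [set x in A | c x == c a].
  have sAi : {subset Ai <= A} by move=> u; rewrite inE => /andP[].
  have p1 := p (c a); have p2 := p' i.
  rewrite (_ : color_class (G :|: D) d i = (G :&: color_class (G :|: A) c (c a)) :|: (D :&:
    color_class (D :|: B) c' i)).
    apply: (IH T _ Ai _ (dual_preim B g Ai) f g).
    * have [j jK jk] : exists2 i, i \in c @: (G :|: A) & i != c a.
        case: qp => K4 _; have : 0 < #|c @: (G :|: A) :\ c a|.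
          rewrite -(leq_add2l (c a \in c @: (G :|: A))) -cardsD1 addn1.
          apply: leq_trans K4; by case: (_ \in _).
        by case/card_gt0P=> k; rewrite !inE => /andP[? ?]; exists k.
      apply: (sub_proper_card sAi) An; apply/eqP=> e.
      case: (fX j jK) => x [xA cx].
      by move: xA; rewrite -e inE cx (negbTE jk) andbF.
    * exact: (dualpair_preim dp sAi).
    * have s1 : {subset G :&: color_class (G :|: A) c (c a) <= G} by move=> u;
      rewrite inE => /andP[].
      have s2 : {subset D :&: color_class (D :|: B) c' i <= D} by move=> u;
        rewrite inE => /andP[].
      have s3 : {subset dual_preim B g Ai <= B} by move=> u; rewrite inE => /andP[].
      split.
      - exact: (dsep_mono sGA s1 sAi).
      - exact: (dsep_mono sGD s1 s2).
      - exact: (dsep_mono sGB s1 s3).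
      - exact: (dsep_mono sAD sAi s2).
      - exact: (dsep_mono sAB sAi s3).
      - exact: (dsep_mono sDB s2 s3).
    * rewrite (_ : _ :|: _ = color_class (G :|: A) c (c a)) //.
      apply/setP=> u; rewrite !in_set.
      by case: (u \in G); case: (u \in A); case: (_ == _).
    * rewrite (_ : _ :|: _ = color_class (D :|: B) c' i) //.
      apply/setP=> u; rewrite !in_set.
      case uD: (u \in D); first by case: (c' u == i) => //=; case uB: (u \in B) => //;
        have := DB u uD; rewrite uB.
      case uB: (u \in B) => //=.
      by rewrite (gB _ uB) sc2 ?gB // (dp_gK dp) // cfa.
  apply/setP=> u; rewrite !in_set /d.
  case uG: (u \in G); case uD: (u \in D) => //=; rewrite ?orbF //.
    by rewrite nD in uD.
  have [rA rc] := repP u uG.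
  by rewrite -rc sc2 // cfa.
Qed.

End CutPrime.

(** * Connectedness of duals and the cut theorem *)

Section Cut.
Variable V : countType.
Implicit Types (T : graph V).

Lemma setU_dual_preim (T : finType) (A B M : {set T}) g :
  {in B, forall y, g y \in A} ->
  dual_preim B g (A :\: M) :|: dual_preim B g M = B.
Proof.
move=> gB; apply/setP=> u; rewrite !inE; case uB: (u \in B) => //=.
by rewrite gB // andbT; case: (g u \in M).
Qed.

Lemma cutsep_sym T (G A D B : {set T}) : cutsep G A D B -> cutsep D B G A.
Proof. by case=> *; split=> //; apply: dsep_sym. Qed.

Lemma module_in_isolated T (U B : {set T}) : dsep U (B :\: U) -> module_in U B.
Proof.
move=> s v vB vU m m' mU m'U; rewrite !(edge_sym v).
by rewrite !dual_edgeE //; apply: s; rewrite // inE vU.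
Qed.

Definition split_off T (U A : {set T}) : Prop :=
  [/\ {subset U <= A}, U != set0, U != A & dsep U (A :\: U)].

Lemma split_offC T (U A : {set T}) : split_off U A -> split_off (A :\: U) A.
Proof.
case=> sU U0 UA s; have e : A :\: (A :\: U) = U.
  by apply/setP=> u; rewrite !inE; move: (sU u); solve_mem.
split; first by move=> u; rewrite inE => /andP[].
- apply: contra UA => /eqP h; rewrite eqEsubset -(setD_eq0 A U) h eqxx andbT.
  exact/subsetP.
- exact: setD_neq.
- by rewrite e; apply: dsep_sym.
Qed.

Lemma connected_or_split T (A : {set T}) : A != set0 -> connected A \/ exists U, split_off U A.
Proof.
move=> A0; case E: [exists U : {set T}, [&& U \subset A, U != set0, U != A &
   [forall x in U, [forall y in A :\: U, dual_edge x y]]]].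
  case/existsP: E => U /and4P[/subsetP sU U0 UA /forall_inP h]; right; exists U.
  split=> // x y xU yU; have /forall_inP h' := h x xU; exact: h'.
left; split=> // U sU s; case: (eqVneq U set0) => [|U0]; first by left.
case: (eqVneq U A) => [|UA]; first by right.
move/negbT/existsPn/(_ U): E; rewrite U0 UA /=.
have -> : U \subset A by apply/subsetP.
by case/negP; apply/forall_inP=> x xU; apply/forall_inP=> y yU; apply: s.
Qed.

(** In the dual, every vertex of [U] is adjacent to every vertex of [A :\: U], so a separated set
    contains the images of all of them or of none. *)
Lemma split_dual_connected T (A B U : {set T}) f g :
  dualpair A B f g -> split_off U A -> connected B.
Proof.
move=> dp [sU U0 UA sep].
have U0' := U0; case/set0Pn: U0' => u0 u0U.
have /subsetPn[v0 v0A v0U] : ~~ (A \subset U).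
  by apply: contra UA => h; rewrite eqEsubset h andbT; apply/subsetP.
split; first by apply/set0Pn; exists (f u0); apply: (dp_f dp); apply: sU.
move=> W sW sepW.
have key u v : u \in U -> v \in A -> v \notin U -> (f u \in W) = (f v \in W).
  move=> uU vA vU; have e : edge (f u) (f v).
    by rewrite (dp_edge dp) ?(sU _ uU) //; apply: sep; rewrite // inE vU.
  apply/idP/idP => [uW|vW]; apply: contraT => nW.
    have := sepW (f u) (f v) uW; rewrite inE nW (dp_f dp) // => /(_ isT) /dual_edgeE.
    by rewrite e.
  have := sepW (f v) (f u) vW; rewrite inE nW (dp_f dp) ?sU // => /(_ isT) /dual_edgeE.
  by rewrite edge_sym e.
have all u : u \in A -> (f u \in W) = (f u0 \in W).
  move=> uA; case uU: (u \in U); last by rewrite -(key u0 u) // uU.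
  by rewrite (key u v0) // (key u0 v0).
case h: (f u0 \in W); [right|left]; apply/setP=> y.
  apply/idP/idP => [/sW //|yB].
  by rewrite -(dp_gK dp yB) all ?(dp_g dp).
rewrite inE; apply/negP=> yW.
by have := all (g y); rewrite (dp_g dp) ?sW // (dp_gK dp) ?sW // yW h => /(_ isT).
Qed.

(** The two sides of a split of [B] would correspond to complementary proper modules of [A], each of
    one colour; two colours are too few. *)
Lemma prime_dual_connected T (A B S Y : {set T}) f g (I : finType) (q : rel I) (c : T -> I) :
  dualpair A B f g -> coloring S A Y c q -> qprime q (c @: S) ->
  (forall i, i \in c @: S -> exists x, x \in A /\ c x = i) -> connected B.
Proof.
move=> dp col qp fX; have dps := dualpair_sym dp.
have single U : split_off U B -> exists k, forall x, x \in dual_preim A f U -> c x = k.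
  case=> sU U0 UB s; case/set0Pn: (U0) => u0 u0U; exists (c (g u0)) => x xU.
  apply: (qprime_module col qp fX _ _ (module_in_dual dps sU (module_in_isolated s))) => //.
  - by move=> u; rewrite inE => /andP[].
  - apply: contraNneq UB => e; rewrite eqEsubset; apply/andP; split; first exact/subsetP.
    apply/subsetP=> y yB; have := dp_g dp yB; rewrite -e inE => /andP[_].
    by rewrite (dp_gK dp).
  - by rewrite inE (dp_g dp) ?sU // (dp_gK dp) ?sU.
have B0 : B != set0.
  case: qp => K4 _; have /card_gt0P[i iK] : 0 < #|c @: S| by apply: leq_trans K4.
  case: (fX i iK) => x [xA _]; apply/set0Pn; exists (f x); exact: (dp_f dp).
case: (connected_or_split B0) => // -[U sU].
have [k1 h1] := single U sU; have [k2 h2] := single _ (split_offC sU).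
have : #|c @: S| <= 2.
  apply: (@leq_trans #|[set k1; k2]|); last by rewrite cards2; case: eqP.
  apply: subset_leq_card; apply/subsetP=> i /fX[x [xA <-]]; rewrite !inE.
  case xU: (f x \in U); first by rewrite h1 ?eqxx // inE xA.
  by rewrite h2 ?eqxx ?orbT // !inE xA xU (dp_f dp).
by case: qp => h _ /(leq_trans h).
Qed.

(** The vertex [x] has the label of [f y], so renaming [f y] to [x] in the derivation of [D :|: B]
    is enough. *)
Lemma cut_ax T (G A D B : {set T}) f g x y :
  dualpair A B f g -> cutsep G A D B -> G = [set x] -> A = [set y] ->
  label x = dual_atom (label y) -> derivable (D :|: B) -> derivable (G :|: D).
Proof.
move=> dp cs eG eA lxy p.
have yA : y \in A by rewrite eA inE.
have fyB := dp_f dp yA.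
have eB : B = [set f y].
  apply/setP=> u; rewrite inE; apply/idP/eqP => [uB|->//].
  by have := dp_g dp uB; rewrite eA inE => /eqP <-; rewrite (dp_gK dp).
have xG : x \in G by rewrite eG inE.
have DB u : u \in D -> u != f y.
  by move=> uD; apply/eqP=> e; have := dsep_disj (csDB cs) uD; rewrite e fyB.
have Dx u : u \in D -> u != x.
  by move=> uD; apply/eqP=> e; have := dsep_disj (csGD cs) xG; rewrite -e uD.
apply: (derivable_bij (g := fun u => if u == f y then x else u) (h :=
  fun u => if u == x then f y else u) _ _ _ _ _ _ p).
- move=> u; rewrite eB eG !inE; case: eqP => [_ _|_]; first by rewrite eqxx.
  by rewrite orbF => ->; rewrite orbT.
- move=> u; rewrite eB eG !inE; case: eqP => [_ _|_]; first by rewrite eqxx orbT.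
  by move=> /= ->.
- move=> u; rewrite eB !inE => /orP[uD|/eqP ->]; last by rewrite !eqxx.
  by rewrite (negbTE (DB u uD)) (negbTE (Dx u uD)).
- move=> u; rewrite eG !inE => /orP[/eqP ->|uD]; first by rewrite !eqxx.
  by rewrite (negbTE (Dx u uD)) (negbTE (DB u uD)).
- move=> u v; rewrite eB !inE => /orP[uD|/eqP ->] /orP[vD|/eqP ->].
  + by rewrite (negbTE (DB u uD)) (negbTE (DB v vD)).
  + rewrite (negbTE (DB u uD)) eqxx (dual_edgeE (csDB cs uD fyB)) edge_sym.
    by rewrite (dual_edgeE (csGD cs xG uD)).
  + rewrite (negbTE (DB v vD)) eqxx [RHS]edge_sym (dual_edgeE (csDB cs vD fyB)).
    by rewrite (dual_edgeE (csGD cs xG vD)).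
  + by rewrite !eqxx !edge_irrefl.
- move=> u; rewrite eB !inE => /orP[uD|/eqP ->]; first by rewrite (negbTE (DB u uD)).
  by rewrite eqxx (dp_lab dp).
Qed.

(** A disconnected [B] cannot be made principal. Instead, if the dual of [M] lies in one side [W] of
    the split, it is deleted from [W], which is smaller than [A], the other side counting as
    context. *)
Lemma cut_plug_split n : cut_lt V n ->
  forall T (G1 G2 A D B M U : {set T}) f g,
  #|A| <= n -> dualpair A B f g -> cutsep (G1 :|: G2) A D B -> dsep G1 G2 ->
  {subset M <= A} -> M != set0 -> M != A -> module_in M A ->
  derivable (G1 :|: M) -> derivable (G2 :|: (A :\: M)) -> split_off U B ->
  derivable (D :|: B) -> derivable ((G1 :|: G2) :|: D).
Proof.
move=> IH T G1 G2 A D B M U f g An dp [sGA sGD sGB sAD sAB sDB] sG12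
  sM M0 MA mM pG1 pG2 sU pB.
have gB : forall u, u \in B -> g u \in A by move=> u uB; rewrite (dp_g dp).
have eB := setU_dual_preim M (dp_g dp).
have sAM : {subset A :\: M <= A} by solve_subset.
suff h : derivable (D :|: G1 :|: dual_preim B g (A :\: M)).
  rewrite (setUC G1 G2) -setUA (setUC G1 D).
  apply: (IH T G2 (A :\: M) (D :|: G1) (dual_preim B g (A :\: M)) f g) => //.
  - exact: setD_proper_card.
  - exact: dualpair_preim dp sAM.
  - by split; solve_dsep.
have mM' := module_in_dual dp sM mM.
have sM' : {subset dual_preim B g M <= B} by solve_subset.
have main W : split_off W B -> {subset dual_preim B g M <= W} ->
    derivable (D :|: G1 :|: dual_preim B g (A :\: M)).
  case=> sW W0 WB sepW MW.
  have sBW : {subset B :\: W <= B} by solve_subset.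
  have -> : D :|: G1 :|: dual_preim B g (A :\: M) =
      (D :|: (B :\: W)) :|: G1 :|: (W :\: dual_preim B g M) :|: set0.
    by apply/setP=> u; move: (MW u) (sW u) (gB u); solve_mem.
  have eW : W :\: dual_preim B g M :|: dual_preim B g M = W.
    by apply/setP=> u; move: (MW u) (sW u) (gB u); solve_mem.
  have sWM : {subset W :\: dual_preim B g M <= W} by move=> u; rewrite inE => /andP[].
  have sWMB : {subset W :\: dual_preim B g M <= B} by move=> u /sWM/sW.
  apply: (@replace_module _ n IH T _ _ (dual_preim B g M) G1 M set0 g f).
  - by rewrite eW; apply: (sub_proper_card sW WB); rewrite -(dualpair_card dp).
  - by apply: dualpair_sym; apply: (dualpair_preim dp sM).
  - by move=> u; rewrite in_setD => /andP[].
  - rewrite eW; apply: dsepUl; last exact: dsep_sym.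
    exact: (dsep_mono sDB _ sW).
  - by solve_dsep.
  - exact: dsep0r.
  - by solve_dsep.
  - exact: dsep0r.
  - exact: dsep0r.
  - by apply: (dsep_mono sGB _ sWMB); solve_subset.
  - by move=> u; rewrite inE.
  - rewrite setU0 => k; rewrite in_setD => /andP[k1 k2]; apply: mM' => //; exact: sW.
  - rewrite eW -setUA (_ : (B :\: W) :|: W = B) //.
    by apply/setP=> u; move: (sW u); solve_mem.
  - by rewrite setU0.
(* A vertex of [B] adjacent to the dual of [M] is adjacent to all of it, which puts this module on
   one side of the split. Without such a vertex the module is itself separated in [B], and [M] is
   cut directly. *)
case: (boolP [exists y in dual_preim B g (A :\: M), [exists m in dual_preim B g M, edge y m]]).
  case/exists_inP=> y; rewrite inE in_setD => /and3P[yB yM yA] /exists_inP[m mM0 eym].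
  have mB : m \in B := sM' m mM0.
  have cM W : split_off W B -> y \in W -> {subset dual_preim B g M <= W}.
    case=> sW _ _ sepW yW m' mm'; apply: contraT => mW.
    have m'B : m' \in B := sM' m' mm'.
    have := sepW y m' yW; rewrite inE mW m'B => /(_ isT) /dual_edgeE.
    by rewrite (mM' y yB _ m' m) ?eym // inE yB.
  case yU: (y \in U); first by apply: (main U sU); apply: cM.
  by apply: (main _ (split_offC sU)); apply: cM; [exact: split_offC | rewrite inE yU].
move=> hM; have sMM : dsep (dual_preim B g M) (dual_preim B g (A :\: M)).
  move=> u v uM vM; apply: (@dual_edge_mem _ _ (dual_preim B g M)) => //.
    by move: vM; rewrite !inE => /and3P[-> /negbTE ->].
  apply: contra hM => e; apply/exists_inP; exists v => //; apply/exists_inP; exists u => //.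
  by rewrite edge_sym.
have -> : D :|: G1 :|: dual_preim B g (A :\: M) = G1 :|: (D :|: dual_preim B g (A :\: M)).
  by rewrite setUA (setUC G1).
apply: (IH T G1 M _ (dual_preim B g M) f g) => //.
- exact: sub_proper_card An.
- exact: dualpair_preim dp sM.
- by split; solve_dsep.
- by rewrite -setUA eB.
Qed.

Lemma cut_connected n : cut_lt V n -> forall T (G A D B : {set T}) f g,
  #|A| <= n -> dualpair A B f g -> cutsep G A D B -> connected A ->
  derivable (G :|: A) -> derivable (D :|: B) -> derivable (G :|: D).
Proof.
move=> IH T G A D B f g An dp cs cA pA pB.
have dps := dualpair_sym dp.
have Bn : #|B| <= n by rewrite -(dualpair_card dp).
case: (cs) => sGA sGD sGB sAD sAB sDB.
apply: (cut_reduce_principal (D := D) (E := B) cA sAD _ pA) => // {sGA sGD sGB cs pA}G.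
move=> sGA sGD sGB; have cs : cutsep G A D B by split.
(* Once [A] is principal, the second derivation is pushed up in turn, with [G] as the replacing
   context. *)
have right : connected B -> (forall D0, cutsep G A D0 B -> principal D0 B ->
  derivable (D0 :|: B) -> derivable (D0 :|: G)) -> derivable (G :|: D).
  move=> cB h; rewrite setUC.
  apply: (cut_reduce_principal (D := G) (E := A) cB (dsep_sym sGB) _ pB) => //;
    try exact: dsep_sym.
  move=> D0 s1 s2 s3 p0 p0'; apply: h p0 p0'.
  by split=> //; apply: dsep_sym.
case=> [x y eG eA lxy|G1 G2 M eG sG12 sM M0 MA mM p1 p2|I q c Y col qp fX fY p] pA.
- exact: (cut_ax dp cs eG eA lxy).
- subst G; have B0 : B != set0.
    case/set0Pn: M0 => m mM0; apply/set0Pn; exists (f m).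
    by apply: (dp_f dp); apply: sM.
  (* Only after a plug rule can [B] be disconnected: the dual of a prime composition is
     connected. *)
  case: (connected_or_split B0) => [cB|[U sU]]; last first.
    exact: (cut_plug_split IH An dp cs sG12 sM M0 MA mM p1 p2 sU pB).
  apply: right => // D0 cs0 [x y eD eB lxy|D1 D2 N eD sD12 sN N0 NB mN q1 q2|I q c Y col qp
    fX fY p] _.
  + exact: (cut_ax dps (cutsep_sym cs0) eD eB lxy).
  + subst D0; rewrite setUC.
    have eN : dual_preim B g (dual_preim A f N) = N.
      apply/setP=> u; rewrite !inE; apply/idP/idP => [/and3P[uB _]|uN].
        by rewrite (dp_gK dp).
      by rewrite sN // (dp_g dp) ?sN // (dp_gK dp) ?sN.
    have eBN : dual_preim B g (A :\: dual_preim A f N) = B :\: N.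
      apply/setP=> u; rewrite !inE; case uB: (u \in B); rewrite ?andbF //=.
      by rewrite (dp_g dp) // (dp_gK dp) // !andbT.
    have sN2 : {subset dual_preim A f N <= A} by move=> u; rewrite inE => /andP[].
    apply: (cut_plug_plug IH (M := M) (M2 := dual_preim A f N) An dp cs0) => //.
    * case/set0Pn: N0 => v vN; apply/set0Pn; exists (g v).
      by rewrite inE (dp_g dp) ?sN // (dp_gK dp) ?sN.
    * apply: contraNneq NB => e; rewrite -eN e; apply/eqP/setP=> u.
      by rewrite inE; case uB: (u \in B) => //=; rewrite (dp_g dp).
    * exact: module_in_dual dps sN mN.
    * by rewrite eN.
    * by rewrite eBN.
  + rewrite setUC.
    exact: (cut_plug_prime IH An dp cs0 sG12 sM M0 MA mM p1 p2 col qp fX p).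
- have cB := prime_dual_connected dp col qp fX.
  apply: right => // D0 cs0 [x y eD eB lxy|D1 D2 N eD sD12 sN N0 NB mN q1 q2|I' q' c' Y' col'
    qp' fX' fY' p'] _.
  + exact: (cut_ax dps (cutsep_sym cs0) eD eB lxy).
  + subst D0.
    exact: (cut_plug_prime IH Bn dps (cutsep_sym cs0) sD12 sN N0 NB mN q1 q2 col qp fX p).
  + rewrite setUC.
    exact: (cut_prime_prime IH An dp cs0 col qp fX p col' qp' fX' p').
Qed.

Theorem derivable_cut T (G A D B : {set T}) f g :
  dualpair A B f g -> cutsep G A D B ->
  derivable (G :|: A) -> derivable (D :|: B) -> derivable (G :|: D).
Proof.
suff H n : cut_lt V n by apply: (H #|A|.+1).
elim: n => // n IH {}T {}G {}A {}D {}B {}f {}g; rewrite ltnS => An dp cs pA pB.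
case: (eqVneq A set0) => [A0|A0].
  have B0 : B = set0.
    by apply/setP=> u; rewrite inE; apply/negP=> /(dp_g dp); rewrite A0 inE.
  by move: pA pB; rewrite A0 B0 !setU0; apply: derivable_union; case: cs.
case: (connected_or_split A0) => [cA|[U sU]].
  exact: (cut_connected IH An dp cs cA pA pB).
rewrite setUC; have cB := split_dual_connected dp sU.
apply: (cut_connected IH _ (dualpair_sym dp) (cutsep_sym cs) cB pB pA).
by rewrite -(dualpair_card dp).
Qed.

End Cut.

(** * From GS to the calculus and back *)

Section FromGS.
Variable V : countType.
Implicit Types (T X Y Z G H : graph V).

Definition full_derivable G : Prop := derivable [set: G].

Lemma full_derivable_iso G H : graph_iso G H -> full_derivable G -> full_derivable H.
Proof.
by case=> f [[g fK gK] fe fl]; apply: (derivable_bij (g := f) (h := g)).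
Qed.

Lemma derivable_imset T T' (g : T -> T') (S : {set T}) :
  {in S &, injective g} -> {in S &, forall u v, edge (g u) (g v) = edge u v} ->
  {in S, forall u, label (g u) = label u} -> derivable S -> derivable (g @: S).
Proof.
move=> gI ge gl p; case: (set_0Vmem S) => [->|[x0 x0S]].
  by rewrite imset0; apply: derivable_nil.
pose h w := odflt x0 [pick x in S | g x == w].
have hK x : x \in S -> h (g x) = x.
  move=> xS; rewrite /h; case: pickP => [y /andP[yS /eqP e]|/(_ x)]; first exact: gI.
  by rewrite xS eqxx.
apply: (derivable_bij (g := g) (h := h)) p => //.
- by move=> x xS; apply: imset_f.
- by move=> _ /imsetP[x xS ->]; rewrite hK.
- by move=> _ /imsetP[x xS ->]; rewrite hK.
Qed.

Lemma full_derivable_map T T' (g : T -> T') : injective g ->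
  (forall u v, edge (g u) (g v) = edge u v) ->
  (forall u, label (g u) = label u) -> full_derivable T -> derivable (g @: [set: T]).
Proof. by move=> gI ge gl; apply: derivable_imset => //; apply: in2W. Qed.

Lemma full_derivable_mp Z Z' : full_derivable Z -> full_derivable (par (dual Z) Z') ->
  full_derivable Z'.
Proof.
move=> p1 p2; pose T := par Z (par (dual Z) Z').
pose S1 : {set T} := [set w : T | if w is inl _ then true else false].
pose S2 : {set T} := [set w : T | if w is inr (inl _) then true else false].
pose S3 : {set T} := [set w : T | if w is inr (inr _) then true else false].
have q1 : derivable (set0 :|: S1).
  rewrite (_ : set0 :|: S1 = (fun x : Z => inl x : T) @: [set: Z]).
    by apply: full_derivable_map p1 => // x y [].
  apply/setP=> -[x|[x|x]]; rewrite !inE; apply/esym.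
  - by apply/imsetP; exists x.
  - by apply/imsetP=> -[].
  - by apply/imsetP=> -[].
have q2 : derivable (S3 :|: S2).
  rewrite (_ : S3 :|: S2 = (fun x : par (dual Z) Z' => inr x : T) @: [set: par (dual Z) Z']).
    by apply: full_derivable_map p2 => // x y [].
  apply/setP=> -[x|x]; rewrite !inE; apply/esym.
  - by apply/imsetP=> -[].
  - by case: x => x; apply/imsetP; [exists (inl x)|exists (inr x)].
have q3 : derivable (set0 :|: S3).
  apply: (derivable_cut (A := S1) (B := S2)
    (f := fun w : T => match w with inl x => inr (inl x) | _ => w end)
    (g := fun w : T => match w with inr (inl x) => inl x | _ => w end) _ _ q1 q2).
  - split.
    + by move=> [x|[x|x]]; rewrite !inE.
    + by move=> [x|[x|x]]; rewrite !inE.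
    + by move=> [x|[x|x]]; rewrite !inE.
    + by move=> [x|[x|x]]; rewrite !inE.
    + by move=> [x|[x|x]]; rewrite !inE.
    + by move=> [x|[x|x]] [y|[y|y]]; rewrite !inE.
  - by split; move=> [x|[x|x]] [y|[y|y]]; rewrite !inE.
apply: (derivable_preim (h := fun x : Z' => inr (inr x) : T) q3) => //.
- apply/setP=> -[x|[x|x]]; rewrite !inE; apply/esym.
  + by apply/imsetP=> -[].
  + by apply/imsetP=> -[].
  + by apply/imsetP; exists x.
- by move=> x y _ _ [].
Qed.

Lemma derivable_pair T (x y : T) (S : {set T}) : label x = dual_atom (label y) -> ~~ edge x y ->
  (forall u, (u \in S) = (u == x) || (u == y)) -> derivable S.
Proof.
move=> l e h; rewrite (_ : S = [set x; y]); first exact: derivable_ax.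
by apply/setP=> u; rewrite h !inE.
Qed.

(** The quotient is [C] with its hole as a vertex [None]. Each vertex of [C] meets its dual in an
    axiom, and the class of the hole is the hypothesis. *)
Lemma full_derivable_plug (C : graph V) (R : {set C}) X Y :
  full_derivable (par (dual X) Y) -> full_derivable (par (dual (plug R X)) (plug R Y)).
Proof.
move=> p; pose T := par (dual (plug R X)) (plug R Y).
pose c (w : T) : option C := match w with
  | inl (inl x) => Some x | inr (inl x) => Some x | _ => None end.
pose q (i j : option C) := match i, j with
  | Some h, Some h' => edge h h' | Some h, None => h \in R
  | None, Some h => h \in R | None, None => false end.
apply: (@derivable_coloring _ T _ q c _ [set w : T | if w is inl _ then true else false]
   [set w : T | if w is inr _ then true else false]).
- split; do ?[by move=> [u|u]; rewrite !inE].
  + by move=> [x|] [y|] //=; rewrite edge_sym.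
  + by move=> [u|u] [v|v]; rewrite !inE.
  + by move=> [u|u] [v|v]; rewrite !inE.
  + move=> [[u|u]|[u|u]] [[v|v]|[v|v]] _ _; rewrite !inE //= /dual_edge /= ?orbF //.
    by move=> cuv; rewrite (_ : inl u != inl v).
- case=> [x|].
    apply: (derivable_pair (x := inl (inl x) : T) (y := inr (inl x) : T)) => //.
    by move=> [[u|u]|[u|u]]; rewrite !inE //= ?orbF.
  rewrite (_ : color_class _ _ _ = (fun w : par (dual X) Y => match w with
     | inl x => inl (inr x) : T | inr y => inr (inr y) end) @: setT).
    apply: full_derivable_map p => //.
    - by move=> [x|x] [y|y] // [->].
    - by move=> [x|x] [y|y].
    - by move=> [x|x].
  apply/setP=> w; rewrite !inE; apply/idP/imsetP.
    by case: w => [[x|x]|[x|x]] // _; [exists (inl x)|exists (inr x)].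
  by case=> -[x|x] _ ->.
Qed.

(** A single colouring with [G] itself as quotient, whose classes are axioms. *)
Lemma full_derivable_id G : full_derivable (par (dual G) G).
Proof.
pose T := par (dual G) G.
pose c (w : T) : G := match w with inl x => x | inr x => x end.
apply: (@derivable_coloring _ T _ (@edge V G) c _ [set w : T | if w is inl _ then true else
  false]
   [set w : T | if w is inr _ then true else false]).
- split; do ?[by move=> [u|u]; rewrite !inE].
  + exact: edge_sym.
  + by move=> [u|u] [v|v]; rewrite !inE.
  + by move=> [u|u] [v|v]; rewrite !inE.
  + by move=> [u|u] [v|v] _ _; rewrite !inE //= /dual_edge /= ?orbF // => ->.
- move=> x; apply: (derivable_pair (x := inl x : T) (y := inr x : T)) => //.
  by move=> [u|u]; rewrite !inE //= ?orbF.
Qed.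

Lemma full_derivable_GS X Y : GS X Y -> full_derivable (par (dual X) Y).
Proof.
case=> [a|A B S S0 A0|P M N Pp P4 M0].
- apply: (derivable_pair (x := inr (inl tt) : par _ (par (atom_graph (dual_atom a))
  (atom_graph a)))
    (y := inr (inr tt) : par _ (par (atom_graph (dual_atom a)) (atom_graph a)))) => //.
  by move=> [[]|[[]|[]]]; rewrite !inE.
(* The quotient is again [B] with a hole, but the positive copy of [A], being joined to nothing, is
   only side context of the colour of the hole. *)
- pose T := par (dual (plug S A)) (par B A).
  pose c (w : T) : option B := match w with
    | inl (inl x) => Some x | inr (inl x) => Some x | _ => None end.
  pose q (i j : option B) := match i, j with
    | Some h, Some h' => edge h h' | Some h, None => h \in S
    | None, Some h => h \in S | None, None => false end.
  apply: (@derivable_coloring _ T _ q c _ [set w : T | if w is inl _ then true else false]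
     [set w : T | if w is inr (inl _) then true else false]).
  + split; do ?[by move=> [u|[u|u]]; rewrite !inE].
    * by move=> [x|] [y|] //=; rewrite edge_sym.
    * by move=> [u|[u|u]] [v|[v|v]]; rewrite !inE.
    * by move=> [u|[u|u]] [v|[v|v]]; rewrite !inE.
    * move=> [[u|u]|[u|u]] [[v|v]|[v|v]] _ _; rewrite !inE //= /dual_edge /= ?orbF //.
      by move=> cuv; rewrite (_ : inl u != inl v).
  + case=> [x|].
      apply: (derivable_pair (x := inl (inl x) : T) (y := inr (inl x) : T)) => //.
      by move=> [[u|u]|[u|u]]; rewrite !inE //= ?orbF.
    rewrite (_ : color_class _ _ _ = (fun w : par (dual A) A => match w with
       | inl x => inl (inr x) : T | inr y => inr (inr y) end) @: setT).
      apply: full_derivable_map (full_derivable_id A) => //.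
      - by move=> [x|x] [y|y] // [->].
      - by move=> [x|x] [y|y].
      - by move=> [x|x].
    apply/setP=> w; rewrite !inE; apply/idP/imsetP.
      by case: w => [[x|x]|[x|x]] // _; [exists (inl x)|exists (inr x)].
    by case=> -[x|x] _ ->.
(* The dual of the tensor is a disjoint union and hence side context; the class [i] is the identity
   on [par (M i) (N i)]. *)
- pose T := par (dual (big_tensor (fun i : P => par (M i) (N i))))
                (par (compose (G := dual P) M) (compose N)).
  pose c (w : T) : P := match w with
    | inl u => tag u | inr (inl u) => tag u | inr (inr u) => tag u end.
  apply: (@derivable_coloring _ T _ (@edge V P) c _ [set w : T | if w is inr (inl _) then
    true else false]
     [set w : T | if w is inr (inr _) then true else false]).
  + split; do ?[by move=> [u|[u|u]]; rewrite !inE].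
    * exact: edge_sym.
    * by move=> [u|[u|u]] [v|[v|v]]; rewrite !inE.
    * by move=> [u|[u|u]] [v|[v|v]]; rewrite !inE.
    * move=> [u|[u|u]] [v|[v|v]] _ _; rewrite !inE //= => cuv.
      - by rewrite /dual_edge /= /subst_edge (negbTE cuv) andbF.
      - by rewrite /subst_edge (negbTE cuv) /= /dual_edge cuv orbF.
      - by rewrite /subst_edge (negbTE cuv).
  + move=> i.
    pose g (w : par (dual (par (M i) (N i))) (par (M i) (N i))) : T := match w with
      | inl u => inl (Tagged (fun i => par (M i) (N i)) u)
      | inr (inl u) => inr (inl (Tagged (fun i : dual P => M i) u))
      | inr (inr u) => inr (inr (Tagged (fun i : P => N i) u)) end.
    rewrite (_ : color_class _ _ _ = g @: setT).
      apply: full_derivable_map (full_derivable_id (par (M i) (N i))) => //.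
      - by move=> [x|[x|x]] [y|[y|y]] //= /eqP; rewrite -[_ == _]/(Tagged _ _ == Tagged _ _)
        eq_Tagged => /eqP /= ->.
      - by move=> [x|[x|x]] [y|[y|y]] //=; rewrite /dual_edge /= /subst_edge /= ?eqxx
        ?tagged_asE // -[_ != _]/(~~ (Tagged _ _ == Tagged _ _)) eq_Tagged.
      - by move=> [x|[x|x]].
    apply/setP=> w; rewrite !inE; apply/idP/imsetP.
      case: w => [[j x]|[[j x]|[j x]]] /= /eqP e; subst.
      - exists (inl x); [by rewrite inE|reflexivity].
      - exists (inr (inl x)); [by rewrite inE|reflexivity].
      - exists (inr (inr x)); [by rewrite inE|reflexivity].
    by case=> -[x|[x|x]] _ -> /=; rewrite eqxx.
Qed.

End FromGS.

(** * GS derivations in contexts and under changing edge relations *)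

Section Relations.
Variable V : countType.
Implicit Types (X Y Z G H : graph V).

Lemma provable_full_derivable G : provable GS G -> full_derivable G.
Proof.
elim=> [|H K _ IH hk].
  rewrite /full_derivable (_ : [set: _] = set0); first exact: derivable_nil.
  by apply/setP=> -[].
case: hk IH => [H' K' iso|C R X Y r] p; first exact: full_derivable_iso iso p.
exact: full_derivable_mp p (full_derivable_plug R (full_derivable_GS r)).
Qed.

(** The dual of the tensor is the par of [dual A] and [A], so this is the identity sequent again. *)
Lemma full_derivable_tensor_dual (A : graph V) : full_derivable (par (dual (tensor A (dual
  A))) empty_graph).
Proof.
pose T := par (dual (tensor A (dual A))) (@empty_graph V).
pose c (w : T) : A := match w with inl (inl x) => x | inl (inr x) => x | inr f =>
  match f with end end.
apply: (@derivable_coloring _ T _ (@edge V A) c _ [set w : T | if w is inl (inl _) then true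
  else false]
   [set w : T | if w is inl (inr _) then true else false]).
- split; do ?[by move=> [[u|u]|[]]; rewrite !inE].
  + exact: edge_sym.
  + by move=> [[u|u]|[]] [[v|v]|[]]; rewrite !inE.
  + by move=> [[u|u]|[]] [[v|v]|[]]; rewrite !inE.
  + move=> [[u|u]|[]] [[v|v]|[]] _ _; rewrite !inE //= /dual_edge /= ?orbF => cuv.
    * by rewrite (_ : inl u != inl v).
    * by rewrite (_ : inr u != inr v) //= /dual_edge cuv /= negbK.
- move=> x; apply: (derivable_pair (x := inl (inl x) : T) (y := inl (inr x) : T)) => //=.
  + by rewrite dual_atomK.
  + by move=> [[u|u]|[]]; rewrite !inE //= ?orbF.
Qed.

Lemma graph_iso_sym G H : graph_iso G H -> graph_iso H G.
Proof.
case=> f [[g fK gK] fe fl]; exists g; split; first by exists f.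
- by move=> v w; rewrite -fe !gK.
- by move=> v; rewrite -fl gK.
Qed.

Lemma derivation_trans (S : rule_system V) G H K :
  derivation S G H -> derivation S H K -> derivation S G K.
Proof. by move=> d; elim=> // H' K' _ IH s; apply: derivation_cons IH s. Qed.

Lemma derivation_iso (S : rule_system V) G H : graph_iso G H -> derivation S G H.
Proof. by move=> i; apply: derivation_cons (derivation_nil _ _) _; apply: step_iso. Qed.

Lemma provable_iso G H : graph_iso G H -> provable GS G -> provable GS H.
Proof. by move=> i p; apply: derivation_trans p (derivation_iso _ i). Qed.

Lemma plug_iso (C : graph V) (R : {set C}) X Y :
  graph_iso X Y -> graph_iso (plug R X) (plug R Y).
Proof.
case=> f [[g fK gK] fe fl].
exists (fun w : plug R X => match w with inl x => inl x : plug R Y | inr x =>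
  inr (f x) end); split.
- exists (fun w : plug R Y => match w with inl x => inl x : plug R X | inr x => inr (g x) end).
    by move=> [x|x] //; rewrite fK.
  by move=> [x|x] //; rewrite gK.
- by move=> [x|x] [y|y] //=.
- by move=> [x|x] //=.
Qed.

Lemma derivation_plug (S : rule_system V) (C : graph V) (R : {set C}) X Y :
  derivation S X Y -> derivation S (plug R X) (plug R Y).
Proof.
elim=> [|H K _ IH hk]; first exact: derivation_nil.
apply: derivation_trans IH _ => {X Y}.
case: hk => {H K}[H K i|D Q X Y r]; first by apply: derivation_iso; apply: plug_iso.
(* Nested contexts compose: [R'] collects the vertices joined to the hole at either level. *)
pose C' := plug R D; pose R' : {set C'} :=
  [set w : C' | match w with inl x => x \in R | inr x => x \in Q end].
have assoc Z : graph_iso (plug R (plug Q Z)) (plug R' Z).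
  exists (fun w : plug R (plug Q Z) => match w with
    | inl x => inl (inl x) : plug R' Z | inr (inl x) => inl (inr x) | inr (inr x) =>
      inr x end); split.
  - exists (fun w : plug R' Z => match w with
    | inl (inl x) => inl x : plug R (plug Q Z) | inl (inr x) => inr (inl x) | inr x =>
      inr (inr x) end).
      by move=> [x|[x|x]].
    by move=> [[x|x]|x].
  - by move=> [x|[x|x]] [y|[y|y]] //=; rewrite inE.
  - by move=> [x|[x|x]].
apply: derivation_trans (derivation_iso _ (assoc X)) _.
apply: derivation_trans _ (derivation_iso _ (graph_iso_sym (assoc Y))).
by apply: derivation_cons (derivation_nil _ _) _; apply: step_rule.
Qed.

Section Relations.
Variables (T : finType) (lab : T -> atom V).
Implicit Types (e : rel T) (S : {set T}).

(* Symmetrized, so that [relgraph] makes sense for every relation. *)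
Definition relgraph_edge e S (u v : {x : T | x \in S}) : bool :=
  (val u != val v) && (e (val u) (val v) || e (val v) (val u)).

Lemma relgraph_sym e S : symmetric (@relgraph_edge e S).
Proof. by move=> u v; rewrite /relgraph_edge eq_sym orbC. Qed.

Lemma relgraph_irrefl e S : irreflexive (@relgraph_edge e S).
Proof. by move=> u; rewrite /relgraph_edge eqxx. Qed.

Definition relgraph e S : graph V :=
  Graph (vert := {x : T | x \in S}) (fun u => lab (val u)) (@relgraph_sym e S)
    (@relgraph_irrefl e S).

Lemma relgraph_edgeE e S (u v : relgraph e S) : symmetric e -> u != v ->
  edge u v = e (val u) (val v).
Proof.
by move=> es uv; rewrite /= /relgraph_edge (inj_eq val_inj) uv es orbb.
Qed.

Lemma iso_relgraph e S H (h : H -> T) : symmetric e -> injective h ->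
  (forall u, h u \in S) -> (forall x, x \in S -> exists u, h u = x) ->
  (forall u, lab (h u) = label u) ->
  (forall u v, u != v -> edge u v = e (h u) (h v)) -> graph_iso H (relgraph e S).
Proof.
move=> es hI hS hsurj hl he.
exists (fun u => exist _ (h u) (hS u) : relgraph e S); split.
- apply: inj_card_bij; first by move=> u v [/hI].
  rewrite card_sig; apply: (@leq_trans #|[set h u | u : H]|); last exact: leq_imset_card.
  apply: subset_leq_card; apply/subsetP=> x; rewrite unfold_in /= => /hsurj[u <-].
  by apply/imsetP; exists u.
- move=> u v; case: (eqVneq u v) => [->|uv]; first by rewrite !edge_irrefl.
  by rewrite relgraph_edgeE ?he // -val_eqE /= (inj_eq hI).
- by move=> u; apply: hl.
Qed.

(** Applications of ss keep the vertices and delete edges, so the set is fixed and the relation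
    varies. *)
Definition provable_on e S := provable GS (relgraph e S).

Lemma provable_on_ext e e' S : symmetric e -> symmetric e' ->
  {in S &, forall u v, u != v -> e u v = e' u v} -> provable_on e S -> provable_on e' S.
Proof.
move=> es es' h; apply: provable_iso; apply: (@iso_relgraph e' S (relgraph e S) (fun u =>
  val u)) => //.
- exact: val_inj.
- by move=> u; apply: (valP u).
- by move=> x xS; exists (exist _ x xS).
- move=> u v uv; rewrite relgraph_edgeE // h ?(inj_eq val_inj) //; exact: valP.
Qed.

Lemma iso_plug_relgraph e S A B (R : {set relgraph e B}) :
  symmetric e -> S = A :|: B -> disj A B ->
  (forall a b, a \in A -> e a (val b) = (b \in R)) ->
  graph_iso (plug R (relgraph e A)) (relgraph e S).
Proof.
move=> es eS AB hR.
apply: (@iso_relgraph _ _ _ (fun w : plug R (relgraph e A) => match w with inl x =>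
  val x | inr x => val x end)) => //.
- move=> [u|u] [v|v] h.
  + by rewrite (val_inj h).
  + by have := AB _ (valP v); rewrite -h (valP u).
  + by have := AB _ (valP u); rewrite h (valP v).
  + by rewrite (val_inj h).
- by move=> [u|u]; rewrite eS inE (valP u) ?orbT.
- move=> x; rewrite eS inE => /orP[xA|xB].
    by exists (inr (exist _ x xA)).
  by exists (inl (exist _ x xB)).
- by move=> [u|u].
- move=> [u|u] [v|v] uv.
  + by rewrite -relgraph_edgeE //; apply: contraNneq uv => ->.
  + by rewrite es hR //; apply: valP.
  + by rewrite hR //; apply: valP.
  + by rewrite -relgraph_edgeE //; apply: contraNneq uv => ->.
Qed.

Lemma iso_plug_empty X : graph_iso X (plug (set0 : {set @empty_graph V}) X).
Proof.
exists (fun x => inr x : plug (set0 : {set @empty_graph V}) X); split=> //.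
exists (fun w : plug (set0 : {set @empty_graph V}) X => match w with inl f =>
  match f with end | inr x => x end) => //.
by move=> [[]|x].
Qed.

Lemma derivation_GS X Y : GS X Y -> derivation GS X Y.
Proof.
move=> r; apply: derivation_trans (derivation_iso _ (iso_plug_empty X)) _.
apply: derivation_trans _ (derivation_iso _ (graph_iso_sym (iso_plug_empty Y))).
by apply: derivation_cons (derivation_nil _ _) _; apply: step_rule.
Qed.

Lemma provable_on_plug e A B : symmetric e -> disj A B ->
  (forall b, b \in B -> {in A &, forall a a', e a b = e a' b}) ->
  provable_on e A -> provable_on e B -> provable_on e (A :|: B).
Proof.
move=> es AB uni pA pB.
pose R := [set b : relgraph e B | [exists a in A, e a (val b)]].
have hR a b : a \in A -> e a (val b) = (b \in R).
  move=> aA; rewrite inE; apply/idP/exists_inP => [h|[a' a'A h]]; first by exists a.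
  by rewrite (uni (val b) (valP b) a a').
apply: (provable_iso (iso_plug_relgraph es (erefl _) AB hR)).
(* The proof of [B] comes first; that of [A] is then replayed in the hole of the context [B]. *)
apply: derivation_trans (derivation_plug R pA).
apply: provable_iso pB.
exists (fun x => inl x : plug R empty_graph); split=> //.
exists (fun w : plug R empty_graph => match w with inr f => match f with end | inl x =>
  x end) => //.
by move=> [x|[]].
Qed.

(** When a side condition of ss fails, no edge joins [A] to [B], so both relations agree and no step
    is made. *)
Lemma provable_on_ss e e' A B : symmetric e -> symmetric e' -> disj A B ->
  (forall b, b \in B -> {in A &, forall a a', e a b = e a' b}) ->
  {in A &, forall a a', e' a a' = e a a'} ->
  {in B &, forall a a', e' a a' = e a a'} ->
  (forall a b, a \in A -> b \in B -> e' a b = false) ->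
  provable_on e (A :|: B) -> provable_on e' (A :|: B).
Proof.
move=> es es' AB uni eA eB eAB p.
pose R := [set b : relgraph e B | [exists a in A, e a (val b)]].
have hR a b : a \in A -> e a (val b) = (b \in R).
  move=> aA; rewrite inE; apply/idP/exists_inP => [h|[a' a'A h]]; first by exists a.
  by rewrite (uni (val b) (valP b) a a').
case: (boolP ((A != set0) && (R != set0))) => [/andP[A0 R0]|h].
  have i1 := graph_iso_sym (iso_plug_relgraph es (erefl _) AB hR).
  have p1 := provable_iso i1 p.
  have nA : nonempty (relgraph e A).
    by case/set0Pn: A0 => a aA; rewrite /nonempty; apply/card_gt0P; exists (exist _ a aA).
  have p2 : provable GS (par (relgraph e B) (relgraph e A)).
    by apply: derivation_trans p1 _; apply: derivation_GS; apply: GS_ss.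
  apply: provable_iso p2.
  apply: (@iso_relgraph _ _ _ (fun w : par (relgraph e B) (relgraph e A) =>
    match w with inl x => val x | inr x => val x end)) => //.
  - move=> [u|u] [v|v] h.
    + by rewrite (val_inj h).
    + by have := AB _ (valP v); rewrite -h (valP u).
    + by have := AB _ (valP u); rewrite h (valP v).
    + by rewrite (val_inj h).
  - by move=> [u|u]; rewrite inE (valP u) ?orbT.
  - move=> x; rewrite inE => /orP[xA|xB].
      by exists (inr (exist _ x xA)).
    by exists (inl (exist _ x xB)).
  - by move=> [u|u].
  - move=> [u|u] [v|v] uv.
    + by rewrite eB ?(valP u) ?(valP v) // -relgraph_edgeE //; apply: contraNneq uv => ->.
    + by rewrite es' eAB // ?(valP u) ?(valP v).
    + by rewrite eAB // ?(valP u) ?(valP v).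
    + by rewrite eA ?(valP u) ?(valP v) // -relgraph_edgeE //; apply: contraNneq uv => ->.
apply: provable_on_ext p => // u v.
have nAB a b : a \in A -> b \in B -> e a b = false.
  move=> aA bB; apply/negP=> eab; case/negP: h; apply/andP; split.
    by apply/set0Pn; exists a.
  by apply/set0Pn; exists (exist _ b bB); rewrite -(hR a).
rewrite !inE => /orP[uA|uB] /orP[vA|vB] _.
- by rewrite eA.
- by rewrite nAB ?eAB.
- by rewrite es es' nAB ?eAB.
- by rewrite eB.
Qed.

End Relations.

End Relations.

(** * Simulation of the sequent calculus in GS *)

Section ToGS.
Variable V : countType.
Implicit Types (X Y Z G H : graph V).

Lemma provable_on_ax (T : graph V) (x y : T) : label x = dual_atom (label y) -> ~~ edge x y ->
  provable_on (@label V T) (@edge V T) [set x; y].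
Proof.
move=> lxy exy; have xy : x != y.
  by apply/eqP=> e; move: lxy; rewrite e; case: (label y).
apply: (@provable_iso _ (par (atom_graph (dual_atom (label y))) (atom_graph (label y)))).
  apply: (@iso_relgraph _ _ _ _ _ _ (fun w : par (atom_graph _) (atom_graph _) =>
    match w with inl _ => x | inr _ => y end)).
  - exact: edge_sym.
  - move=> [[]|[]] [[]|[]] // e; by move: xy; rewrite e eqxx.
  - by move=> [u|u]; rewrite !inE eqxx ?orbT.
  - by move=> u; rewrite !inE => /orP[]/eqP ->; [exists (inl tt)|exists (inr tt)].
  - by move=> [u|u].
  - move=> [[]|[]] [[]|[]] //= _; first by rewrite (negbTE exy).
    by rewrite edge_sym (negbTE exy).
by apply: derivation_GS; apply: GS_ai.
Qed.

Lemma provable_on_set0 (T : finType) lab (e : rel T) : symmetric e ->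
  @provable_on V T lab e set0.
Proof.
move=> es; apply: (@provable_iso _ empty_graph); last exact: derivation_nil.
apply: (@iso_relgraph _ _ _ _ _ _ (fun w : empty_graph => match w with end)) => //.
by move=> x; rewrite inE.
Qed.

Section Prime.
Variables (T : graph V) (I : finType) (q : rel I) (c : T -> I) (S X Y : {set T}).
Hypotheses (col : coloring S X Y c q) (qp : qprime q (c @: S))
  (fX : forall i, i \in c @: S -> exists x, x \in X /\ c x = i)
  (pS : forall i, provable_on (@label V T) (@edge V T) (color_class S c i)).

(* Interpolates between the tensor of the premises, for [J] empty, and the premise
   of p: the side contexts of the colours in [J] have been moved out by ss. *)
Definition stage (J : seq I) (u v : T) : bool :=
  if c u == c v then edge u v
  else ((c u \in J) ==> (u \in X :|: Y)) && ((c v \in J) ==> (v \in X :|: Y)).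

Lemma stage_sym J : symmetric (stage J).
Proof. by move=> u v; rewrite /stage eq_sym edge_sym andbC. Qed.

Lemma provable_on_stage_nil_sub (s : seq I) : provable_on (@label V T) (stage [::]) [set u in
  S | c u \in s].
Proof.
elim: s => [|i s IH].
  rewrite (_ : [set _ in _ | _] = set0); first by apply: provable_on_set0; apply: stage_sym.
  by apply/setP=> u; rewrite !inE andbF.
case iS: (i \in s).
  rewrite (_ : [set u in S | c u \in i :: s] = [set u in S | c u \in s]) //.
  by apply/setP=> u; rewrite !inE; case: eqP => // ->; rewrite iS.
rewrite (_ : [set u in S | c u \in i :: s] = color_class S c i :|: [set u in S | c u \in s]);
  last first.
  by apply/setP=> u; rewrite !inE andb_orr.
apply: provable_on_plug => //.
- exact: stage_sym.
- by move=> u; rewrite !inE => /andP[-> /eqP ->]; rewrite iS.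
- move=> b; rewrite inE => /andP[bS cb] a a'; rewrite !inE =>
  /andP[_ /eqP ca] /andP[_ /eqP ca'].
  have ib : (i == c b) = false by apply: contraFF iS => /eqP ->.
  by rewrite /stage ca ca' ib.
- apply: provable_on_ext (pS i); [exact: edge_sym | exact: stage_sym |].
  by move=> u v; rewrite !inE => /andP[_ /eqP cu] /andP[_ /eqP cv] _; rewrite /stage cu cv eqxx.
Qed.

(** One use of ss per colour. The side context of colour [i] has no edge to the rest of its class
    and sees every vertex of another colour uniformly, so it moves out as a whole. *)
Lemma provable_on_stage (J : seq I) : provable_on (@label V T) (stage J) S.
Proof.
elim: J => [|i J IH].
  have := provable_on_stage_nil_sub (enum I); rewrite (_ : [set u in S | c u \in enum I] = S)
    //.
  by apply/setP=> u; rewrite inE mem_enum inE andbT.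
case iJ: (i \in J).
  apply: provable_on_ext IH; try exact: stage_sym.
  move=> u v _ _ _; rewrite /stage !inE.
  by case: (c u =P i) => [->|_]; case: (c v =P i) => [->|_]; rewrite ?iJ.
pose A := color_class S c i :\: (X :|: Y).
have eS : S = A :|: (S :\: A).
  by apply/setP=> u; rewrite !inE; case: (u \in S) => //=; rewrite ?andbF // andbT;
    case: (_ && _).
have hA u : u \in A -> [/\ u \in S, c u = i, u \notin X & u \notin Y].
  by rewrite !inE negb_or => /andP[/andP[-> ->] /andP[-> /eqP ->]].
have nA b : b \in S :\: A -> c b = i -> b \in X :|: Y.
  rewrite in_setD => /andP[bA bS] cb; apply: contraNT bA => bXY.
  by rewrite in_setD bXY inE bS cb eqxx.
have e0 a b : a \in A -> b \in S :\: A -> c b = i -> edge a b = false.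
  move=> /hA[aS ca aX aY] bSA cb; have bS : b \in S by move: bSA; rewrite in_setD => /andP[].
  rewrite edge_sym; apply: dual_edgeE; have := nA b bSA cb; rewrite in_setU => /orP[bX|bY].
    by apply: (col_sepX col); rewrite // in_setD aX aS.
  by apply: (col_sepY col); rewrite // in_setD aY aS.
rewrite eS in IH *.
apply: provable_on_ss IH; try exact: stage_sym.
- by move=> u uA; rewrite in_setD uA.
- move=> b bSA a a' aA a'A; have [aS ca aX aY] := hA a aA; have [a'S ca' _ _] := hA a' a'A.
  rewrite /stage ca ca' iJ /=; case: (i =P c b) => // e.
  by rewrite (e0 a b) // (e0 a' b).
- move=> a a' aA a'A; have [aS ca aX aY] := hA a aA; have [a'S ca' _ _] := hA a' a'A.
  by rewrite /stage ca ca' eqxx.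
- have key b : b \in S :\: A ->
      ((c b \in i :: J) ==> (b \in X :|: Y)) = ((c b \in J) ==> (b \in X :|: Y)).
    move=> bSA; rewrite inE; case: (c b =P i) => //= e.
    by rewrite (nA b bSA e) implybT.
  by move=> a a' aA a'A; rewrite /stage !key.
- move=> a b aA bSA; have [aS ca aX aY] := hA a aA; rewrite /stage ca.
  case: (i =P c b) => [e|_]; first exact: e0.
  by rewrite inE eqxx /= in_setU (negbTE aX) (negbTE aY).
Qed.

(** Rule p takes a labelled graph, hence the constant label [a]; a vertex of [S] will supply it. *)
Definition quotient (a : atom V) : graph V := relgraph (fun _ : I => a) q (c @: S).

Lemma quotient_prime a : prime_graph (quotient a).
Proof.
case: (qp) => K4 hp; have cP : #|quotient a| = #|c @: S| by rewrite card_sig; apply: eq_card.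
split; first by rewrite cP; apply: leq_trans K4.
move=> M mM; pose J := [set val x | x in M].
have sJ : {subset J <= c @: S} by move=> _ /imsetP[x _ ->]; apply: valP.
have injM : #|J| = #|M| by rewrite card_imset //; apply: val_inj.
have qs := col_sym col.
case: (hp J sJ) => [k j j' kK kJ /imsetP[x xM ->] /imsetP[x' x'M ->]|J1|JK].
- pose v : quotient a := exist _ k kK.
  have vM : v \notin M by apply: contra kJ => vM; apply/imsetP; exists v.
  have ed w : w \in M -> edge v w = q k (val w).
    by move=> wM; rewrite relgraph_edgeE //; apply: contraNneq vM => ->.
  by case: (mM v vM) => h; rewrite -!ed //; [rewrite (h _ xM) (h _ x'M) | rewrite (negbTE (h
    _ xM)) (negbTE (h _ x'M))].
- case: (set_0Vmem M) => [->|[v vM]]; first by constructor 1.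
  constructor 2; exists v; apply/eqP; rewrite eq_sym eqEcard sub1set vM cards1.
  by rewrite -injM.
- constructor 3; apply/eqP; by rewrite eqEcard subsetT cardsT cP -JK injM /=.
Qed.

Lemma quotient_card a : 4 <= #|quotient a|.
Proof. by rewrite card_sig; case: qp => K4 _; apply: leq_trans K4 _;
  apply/eq_leq/esym/eq_card. Qed.

Lemma provable_on_prime : provable_on (@label V T) (@edge V T) S.
Proof.
have es : symmetric (@edge V T) by apply: edge_sym.
case: (set_0Vmem S) => [->|[x0 x0S]]; first exact: provable_on_set0.
pose P := quotient (label x0).
pose gT := relgraph (@label V T) (@edge V T).
pose M (i : P) := gT (X :&: color_class S c (val i)).
pose N (i : P) := gT (Y :&: color_class S c (val i)).
(* The side contexts of all colours, once moved out, are the context in which p is applied, joined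
   to nothing. *)
pose C := gT (S :\: (X :|: Y)).
have M0 i : nonempty (M i).
  case: (fX (valP i)) => x [xX cx]; apply/card_gt0P.
  have xS : x \in X :&: color_class S c (val i) by rewrite !inE xX (col_X col xX) cx eqxx.
  by exists (exist _ x xS).
pose h1 (w : plug (set0 : {set C}) (big_tensor (fun i : P => par (M i) (N i)))) : T :=
  match w with inl x => val x | inr u => match tagged u with inl m => val m | inr m =>
    val m end end.
pose h2 (w : plug (set0 : {set C}) (par (compose (G := dual P) M) (compose N))) : T :=
  match w with inl x => val x | inr (inl u) => val (tagged u) | inr (inr u) =>
    val (tagged u) end.
have inC (x : C) : [/\ val x \in S, val x \notin X & val x \notin Y].
  by have := valP x; rewrite !inE negb_or => /andP[/andP[-> ->] ->].
have inM i (x : M i) : [/\ val x \in S, val x \in X, val x \notin Y & c (val x) = val i].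
  have := valP x; rewrite inE => /andP[xX]; rewrite inE => /andP[-> /eqP ->].
  by rewrite xX (col_XY col xX).
have inN i (x : N i) : [/\ val x \in S, val x \notin X, val x \in Y & c (val x) = val i].
  have := valP x; rewrite inE => /andP[xY]; rewrite inE => /andP[-> /eqP ->].
  by rewrite xY (col_XY (coloring_swap col) xY).
have sX a b : a \in X -> b \in S -> b \notin X -> edge a b = false.
  by move=> aX bS bX; apply: dual_edgeE; apply: (col_sepX col); rewrite // in_setD bX.
have sY a b : a \in Y -> b \in S -> b \notin Y -> edge a b = false.
  by move=> aX bS bX; apply: dual_edgeE; apply: (col_sepY col); rewrite // in_setD bX.
have eqM i j (m : M i) (m' : M j) : val m = val m' -> i = j.
  by move=> e; apply: val_inj; have [_ _ _ <-] := inM i m; have [_ _ _ <-] := inM j m';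
    rewrite e.
have eqN i j (m : N i) (m' : N j) : val m = val m' -> i = j.
  by move=> e; apply: val_inj; have [_ _ _ <-] := inN i m; have [_ _ _ <-] := inN j m';
    rewrite e.
have CM (x : C) i (m : M i) : val x = val m -> False.
  by move=> e; have [_ + _] := inC x; have [_ + _ _] := inM i m; rewrite -e => ->.
have CN (x : C) i (m : N i) : val x = val m -> False.
  by move=> e; have [_ _ +] := inC x; have [_ _ + _] := inN i m; rewrite -e => ->.
have MN i (m : M i) j (n : N j) : val m = val n -> False.
  by move=> e; have [_ + _ _] := inM i m; have [_ + _ _] := inN j n; rewrite e => /negbTE ->.
have CS x : x \in S -> x \notin X -> x \notin Y -> x \in S :\: (X :|: Y).
  by move=> xS xX xY; rewrite !inE negb_or xX xY.
have cK x : x \in S -> c x \in c @: S by apply: imset_f.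
have XM x : x \in S -> x \in X -> x \in X :&: color_class S c (c x).
  by move=> xS xX; rewrite !inE xS xX eqxx.
have YN x : x \in S -> x \in Y -> x \in Y :&: color_class S c (c x).
  by move=> xS xX; rewrite !inE xS xX eqxx.
have edC (x x' : C) : x != x' -> edge x x' = edge (val x) (val x').
  by move=> xx'; rewrite relgraph_edgeE.
have eCM (x : C) i (m : M i) : edge (val m) (val x) = false.
  by have [? ? ?] := inC x; have [? ? ? ?] := inM i m; apply: sX.
have eCN (x : C) i (m : N i) : edge (val m) (val x) = false.
  by have [? ? ?] := inC x; have [? ? ? ?] := inN i m; apply: sY.
have eMN i (m : M i) j (n : N j) : edge (val m) (val n) = false.
  by have [? ? ? ?] := inM i m; have [? ? ? ?] := inN j n; apply: sX.
have stC (x : C) y : edge (val x) y = false -> stage (enum I) (val x) y = false.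
  by move=> e; rewrite /stage e mem_enum inE in_setU;
    have [_ /negbTE -> /negbTE ->] := inC x; rewrite /= if_same.
(* The last stage is the premise of p beside [C]; [iso2] does the same for the conclusion and
   [S]. *)
have iso1 : graph_iso (plug (set0 : {set C}) (big_tensor (fun i : P =>
  par (M i) (N i)))) (relgraph (@label V T) (stage (enum I)) S).
  apply: (iso_relgraph (h := h1)).
  - exact: stage_sym.
  - move=> [x|[i [m|n]]] [x'|[j [m'|n']]] /= e.
    + by rewrite (val_inj e).
    + by case: (CM _ _ _ e).
    + by case: (CN _ _ _ e).
    + by case: (CM _ _ _ (esym e)).
    + by have ij := eqM _ _ _ _ e; subst j; rewrite (val_inj e).
    + by case: (MN _ _ _ _ e).
    + by case: (CN _ _ _ (esym e)).
    + by case: (MN _ _ _ _ (esym e)).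
    + by have ij := eqN _ _ _ _ e; subst j; rewrite (val_inj e).
  - move=> [x|[i [m|n]]] /=; [by case: (inC x)|by case: (inM i m)|by case: (inN i n)].
  - move=> x xS; case xX: (x \in X).
      by exists (inr (Tagged (fun i : P => par (M i) (N i)) (inl (exist _ x (XM x xS xX)) :
        par (M (exist _ (c x) (cK x xS))) (N (exist _ (c x) (cK x xS)))))).
    case xY: (x \in Y).
      by exists (inr (Tagged (fun i : P => par (M i) (N i)) (inr (exist _ x (YN x xS xY)) :
        par (M (exist _ (c x) (cK x xS))) (N (exist _ (c x) (cK x xS)))))).
    by exists (inl (exist _ x (CS x xS (negbT xX) (negbT xY)))).
  - by move=> [x|[i [m|n]]].
  - move=> [x|u] [x'|v] uv.
    + have xx' : x != x' by apply: contraNneq uv => ->.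
      rewrite [LHS](edC x x' xx') /=; case: (boolP (edge (val x) (val x'))) => e;
        last by rewrite stC // (negbTE e).
      rewrite /stage; case: eqP => // /eqP cxx'; move: e.
      have [xS /negbTE nX /negbTE nY] := inC x; have [x'S _ _] := inC x'.
      by rewrite (col_edge col) // nX nY.
    + rewrite /= inE stC //; case: v {uv} => j [m|n] /=; by rewrite edge_sym ?eCM ?eCN.
    + rewrite /= inE stage_sym stC //; case: u {uv} => j [m|n] /=;
      by rewrite edge_sym ?eCM ?eCN.
    + case: u v uv => i m [j m'] uv; rewrite /= /subst_edge /=.
      case: eqP => [ij|ij].
        subst j; rewrite tagged_asE.
        have cc (k : par (M i) (N i)) : c (match k with inl m => val m | inr m =>
          val m end) = val i.
          by case: k => k; [case: (inM i k)|case: (inN i k)].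
        rewrite /stage !cc eqxx; case: m m' uv => [m|n] [m'|n'] uv /=.
        * by rewrite -relgraph_edgeE //; apply: contraNneq uv => ->.
        * by rewrite eMN.
        * by rewrite edge_sym eMN.
        * by rewrite -relgraph_edgeE //; apply: contraNneq uv => ->.
      have cc k (m0 : par (M k) (N k)) : c (match m0 with inl m => val m | inr m =>
        val m end) = val k.
        by case: m0 => m0; [case: (inM k m0)|case: (inN k m0)].
      have cXY k (m0 : par (M k) (N k)) : (match m0 with inl m => val m | inr m =>
        val m end) \in X :|: Y.
        by rewrite in_setU; case: m0 => m0; [case: (inM k m0) => _ ->|case: (inN k m0) =>
          _ _ ->; rewrite orbT].
      by rewrite /stage !cc !cXY !implybT (inj_eq val_inj); case: eqP.
have iso2 : graph_iso (plug (set0 : {set C}) (par (compose (G :=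
  dual P) M) (compose N))) (relgraph (@label V T) (@edge V T) S).
  apply: (iso_relgraph (h := h2)).
  - exact: edge_sym.
  - move=> [x|[[i m]|[i n]]] [x'|[[j m']|[j n']]] /= e.
    + by rewrite (val_inj e).
    + by case: (CM _ _ _ e).
    + by case: (CN _ _ _ e).
    + by case: (CM _ _ _ (esym e)).
    + by have ij := eqM _ _ _ _ e; subst j; rewrite (val_inj e).
    + by case: (MN _ _ _ _ e).
    + by case: (CN _ _ _ (esym e)).
    + by case: (MN _ _ _ _ (esym e)).
    + by have ij := eqN _ _ _ _ e; subst j; rewrite (val_inj e).
  - move=> [x|[[i m]|[i n]]] /=; [by case: (inC x)|by case: (inM i m)|by case: (inN i n)].
  - move=> x xS; case xX: (x \in X).
      by exists (inr (inl (Tagged (fun i : dual P => M i) (exist _ x (XM x xS xX) : M (exist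
        _ (c x) (cK x xS)))))).
    case xY: (x \in Y).
      by exists (inr (inr (Tagged (fun i : P => N i) (exist _ x (YN x xS xY) : N (exist _ (c
        x) (cK x xS)))))).
    by exists (inl (exist _ x (CS x xS (negbT xX) (negbT xY)))).
  - by move=> [x|[[i m]|[i n]]].
  - have qP (i j : P) : i != j -> edge i j = q (val i) (val j).
      by move=> ij; rewrite relgraph_edgeE //; apply: (col_sym col).
    move=> [x|[[i m]|[i n]]] [x'|[[j m']|[j n']]] uv.
    + by rewrite [LHS](edC x x') //; apply: contraNneq uv => ->.
    + by rewrite /= inE edge_sym eCM.
    + by rewrite /= inE edge_sym eCN.
    + by rewrite /= inE eCM.
    + rewrite /= /subst_edge /=; case: eqP => [ij|/eqP ij].
        by subst j; rewrite tagged_asE -relgraph_edgeE //; apply: contraNneq uv => ->.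
      have [mS mX mY cm] := inM i m; have [mS' mX' mY' cm'] := inM j m'.
      rewrite (col_edge col) ?cm ?cm' ?(inj_eq val_inj) //.
      by rewrite mX mX' (negbTE mY) orbF /dual_edge ij qP.
    + by rewrite /= eMN.
    + by rewrite /= inE eCN.
    + by rewrite /= edge_sym eMN.
    + rewrite /= /subst_edge /=; case: eqP => [ij|/eqP ij].
        by subst j; rewrite tagged_asE -relgraph_edgeE //; apply: contraNneq uv => ->.
      have [mS mX mY cm] := inN i n; have [mS' mX' mY' cm'] := inN j n'.
      rewrite (col_edge col) ?cm ?cm' ?(inj_eq val_inj) //.
      by rewrite mY mY' (negbTE mX) /= -qP.
apply: (provable_iso iso2); apply: derivation_trans (provable_iso (graph_iso_sym iso1)
  (provable_on_stage (enum I))) _.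
apply: derivation_plug; apply: derivation_GS; apply: GS_p => //.
- exact: quotient_prime.
- exact: quotient_card.
Qed.

End Prime.

Lemma derivable_provable_on (T : graph V) (S : {set T}) : derivable S ->
  provable_on (@label V T) (@edge V T) S.
Proof.
have es : symmetric (@edge V T) by apply: edge_sym.
elim=> {S} [|x y lxy exy|S1 S2 M R dS sM sR sep he p1 IH1 p2 IH2|I q c S X Y col qp fX fY p IH].
- exact: provable_on_set0.
- exact: provable_on_ax.
(* First all of [S1], and not only [M], is joined to [R], so that the whole first premise fills the
   hole; ss then moves [S1 :\: M] out. *)
- pose e (u v : T) := if (u \in S1) && (v \in S2) then v \in R
    else if (u \in S2) && (v \in S1) then u \in R else edge u v.
  have ees : symmetric e.
    move=> u v; rewrite /e; move: (dS u) (dS v).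
    case: (u \in S1); case: (u \in S2); case: (v \in S1); case: (v \in S2) => //=;
      do ?[by move=> /(_ isT)]; do ?[by move=> _ /(_ isT)]; by rewrite ?edge_sym.
  have nS2 u : u \in S2 -> (u \in S1) = false by move=> u2; apply/negP=> /dS; rewrite u2.
  have nS1 u : u \in S1 -> (u \in S2) = false by move/dS/negbTE.
  have q : provable_on (@label V T) e (S1 :|: S2).
    apply: provable_on_plug => //.
    - by move=> b b2 a a' a1 a'1; rewrite /e a1 a'1 b2.
    - by apply: provable_on_ext IH1 => // u v u1 v1 _; rewrite /e u1 v1 !nS1 // !andbF.
    - by apply: provable_on_ext IH2 => // u v u1 v1 _; rewrite /e u1 v1 !nS2 // !andbF.
  have eq : S1 :|: S2 = (S1 :\: M) :|: (M :|: S2).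
    by apply/setP=> u; move: (sM u); solve_mem.
  rewrite eq in q *.
  apply: provable_on_ss q => //.
  - move=> u; rewrite !inE => /andP[uM u1]; by rewrite (negbTE uM) nS1.
  - move=> b hb a a'; rewrite !in_setD => /andP[aM a1] /andP[a'M a'1];
    rewrite /e a1 a'1 (nS1 a a1) (nS1 a' a'1) /=.
    move: hb; rewrite inE => /orP[bM|b2]; last by rewrite b2.
    rewrite nS1 ?sM //.
    by rewrite !(edge_sym _ b) !dual_edgeE //; apply: sep; rewrite // in_setD ?aM ?a'M.
  - move=> a a'; rewrite !in_setD => /andP[aM a1] /andP[a'M a'1];
    by rewrite /e a1 a'1 (nS1 a a1) (nS1 a' a'1) ?andbF.
  - have key b b' : b \in M -> b' \in S2 -> edge b b' = e b b'.
      by move=> bM b2; rewrite /e sM // b2 /= he ?sM // bM.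
    move=> b b'; rewrite !inE => /orP[bM|b2] /orP[b'M|b'2].
    + by rewrite /e (nS1 b (sM _ bM)) (nS1 b' (sM _ b'M)) !andbF.
    + exact: key.
    + by rewrite edge_sym ees; apply: key.
    + by rewrite /e (nS2 b) // (nS2 b') // andbF.
  - move=> a b; rewrite in_setD => /andP[aM a1]; rewrite inE => /orP[bM|b2].
      by rewrite edge_sym; apply: dual_edgeE; apply: sep; rewrite // in_setD aM.
    by rewrite he // (negbTE aM).
- exact: (provable_on_prime col qp fX IH).
Qed.

Lemma full_derivable_provable G : full_derivable G -> provable GS G.
Proof.
move/derivable_provable_on; apply: provable_iso; apply: graph_iso_sym.
apply: (@iso_relgraph _ _ _ _ _ _ id) => //.
- exact: edge_sym.
- by move=> x _; exists x.
Qed.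

End ToGS.

Theorem theorem5p4 (V : countType) (C : graph V) (R : {set C}) (A : graph V) :
  provable GS (plug R (tensor A (dual A))) -> provable GS (plug R empty_graph).
Proof.
move=> /provable_full_derivable p; apply: full_derivable_provable; apply: full_derivable_mp p _.
exact: full_derivable_plug (full_derivable_tensor_dual A).
Qed.
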